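(* Let $(a_n)_{n\ge 0}$ and $(b_n)_{n\ge 0}$ be two infinite admissible sequences of integer partial quotients for Jacobi's algorithm, so that the multidimensional continued fraction $[(a_0,a_1,\ldots),(b_0,b_1,\ldots)]$ converges to a pair of real numbers $(\alpha_0,\beta_0)$, and let $\delta>0$. If $$a_n>\max\{|\tilde A_n|\,C_{n-1}^{\delta},\ |\tilde B_n|\,C_{n-1}^{\delta}\}\qquad\text{for all } n\in\mathbb{N},$$ then $\alpha_0$ and $\beta_0$ are transcendental numbers, and they are rationally independent (linearly independent over $\mathbb{Q}$).
   Context: $\mathbb{N}=\{1,2,3,\ldots\}$. Jacobi's algorithm applied to $(\alpha_0,\beta_0)\in\mathbb{R}^2$ produces, for $n\ge 0$, $a_n=\lfloor\alpha_n\rfloor$, $b_n=\lfloor\beta_n\rfloor$, $\alpha_{n+1}=\frac{1}{\beta_n-b_n}$, $\beta_{n+1}=\frac{\alpha_n-a_n}{\beta_n-b_n}$. Two infinite integer sequences $(a_n)_{n\geq 0}$, $(b_n)_{n\ge 0}$ are admissible if for all $n\ge 1$: $a_n\ge 1$, $b_n\ge 0$, $a_n\ge b_n$, and $b_{n+1}\ge 1$ whenever $a_n=b_n$. These are exactly the pairs of infinite sequences produced by Jacobi's algorithm from some pair of real numbers. Define, for $n\ge 0$, $A_n=a_nA_{n-1}+b_nA_{n-2}+A_{n-3}$, $B_n=a_nB_{n-1}+b_nB_{n-2}+B_{n-3}$, $C_n=a_nC_{n-1}+b_nC_{n-2}+C_{n-3}$, with $(A_{-3},A_{-2},A_{-1})=(0,0,1)$,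 $(B_{-3},B_{-2},B_{-1})=(0,1,0)$, $(C_{-3},C_{-2},C_{-1})=(1,0,0)$. For admissible infinite sequences the limits $\alpha_0=\lim_{n} A_n/C_n$ and $\beta_0=\lim_{n} B_n/C_n$ exist, and the MCF is said to converge to $(\alpha_0,\beta_0)$. Finally $\tilde A_n=A_nC_{n-1}-C_nA_{n-1}$ and $\tilde B_n=B_nC_{n-1}-B_{n-1}C_n$. *)

(* Defs.v *)
(* World: MathComp with MathComp-Analysis. *)
From HB Require Import structures.
From mathcomp Require Import all_boot all_order all_algebra.
From mathcomp Require Import all_classical all_reals all_analysis.

Set Implicit Arguments.
Unset Strict Implicit.
Unset Printing Implicit Defensive.

Import Order.TTheory GRing.Theory Num.Theory.
Import numFieldNormedType.Exports.

Local Open Scope ring_scope.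
Local Open Scope classical_set_scope.

Definition admissible (a b : nat -> int) : Prop :=
  forall n : nat, (1 <= n)%N ->
    [/\ 1 <= a n, 0 <= b n, b n <= a n & a n = b n -> 1 <= b n.+1].

(* All indices are shifted by 3, so that the initial values at -3, -2, -1 sit
   at 0, 1, 2: [mcf_rec a b x y z k] is the term of index k - 3 of the sequence
   u_n = a_n u_(n-1) + b_n u_(n-2) + u_(n-3), (u_(-3), u_(-2), u_(-1)) =
   (x, y, z). *)
Fixpoint mcf_rec (a b : nat -> int) (x y z : int) (k : nat) {struct k} : int :=
  match k with
  | 0 => x
  | 1 => y
  | 2 => z
  | S (S (S n as n1) as n2) =>
      a n * mcf_rec a b x y z n2 + b n * mcf_rec a b x y z n1
        + mcf_rec a b x y z n
  end.

(* With the same shift, A_n = mcfA a b n.+3 and A_(n-1) = mcfA a b n.+2;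
   likewise for B and C. *)
Definition mcfA (a b : nat -> int) : nat -> int := mcf_rec a b 0 0 1.
Definition mcfB (a b : nat -> int) : nat -> int := mcf_rec a b 0 1 0.
Definition mcfC (a b : nat -> int) : nat -> int := mcf_rec a b 1 0 0.

(* The index of tildeA and tildeB is not shifted. *)
Definition tildeA (a b : nat -> int) (n : nat) : int :=
  mcfA a b n.+3 * mcfC a b n.+2 - mcfC a b n.+3 * mcfA a b n.+2.

Definition tildeB (a b : nat -> int) (n : nat) : int :=
  mcfB a b n.+3 * mcfC a b n.+2 - mcfB a b n.+2 * mcfC a b n.+3.

Definition mcf_converges (R : realType) (a b : nat -> int) (alpha beta : R) :
    Prop :=
  ((fun n : nat => (mcfA a b n.+3)%:~R / (mcfC a b n.+3)%:~R : R)
     @ \oo --> alpha) /\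
  ((fun n : nat => (mcfB a b n.+3)%:~R / (mcfC a b n.+3)%:~R : R)
     @ \oo --> beta).

Definition transcendental (R : realType) (x : R) : Prop :=
  ~ algebraicOver (ratr : rat -> R) x.

(* [free] does not apply: R is not a finite-dimensional vector space over
   rat. *)
Definition rationally_independent (R : realType) (x y : R) : Prop :=
  forall p q : rat, ratr p * x + ratr q * y = 0 -> p = 0 /\ q = 0.

(* Main.v *)
(* Consecutive convergents satisfy A_n/C_n - A_(n-1)/C_(n-1) =
   tilde A_n / (C_n C_(n-1)) and C_n >= a_n C_(n-1), so the growth hypothesis
   makes the convergents approximate alpha_0 within 2 C_n^(-2-delta).  The three
   consecutive vectors (A, B, C) have determinant 1, hence tilde A_n and
   tilde B_n never vanish together, a_n >= 2 and C_n -> oo.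
   If alpha_0 were algebraic, Roth's theorem would bound the denominators of the
   reduced convergents; the convergents would then be eventually constant, so
   tilde A_n = 0 for all large n, and running the recurrence of tilde A backwards
   contradicts tilde A_0 = -1 (tilde B_1 = 1 for beta_0).  An integral relation
   P alpha_0 + Q beta_0 = 0 forces the integer P A_n + Q B_n to vanish for large
   n, and again the backward recurrence gives P = Q = 0.

   Roth's theorem follows the classical route: Siegel's lemma yields an integer
   polynomial in m variables of large index at (alpha, ..., alpha); its index at
   a tuple of very good approximations (p_h/q_h) is then still positive, which
   contradicts Roth's lemma.  The latter is proved by induction on m by
   factoring a generalized Wronskian as U(x_m) V(x_1, ..., x_(m-1)). *)

Require Import Defs.
From HB Require Import structures.
From mathcomp Require Import all_boot all_order all_fingroup all_algebra.
From mathcomp Require Import all_classical all_reals all_analysis.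
From mathcomp Require Import ring lra zify.

Set Implicit Arguments.
Unset Strict Implicit.
Unset Printing Implicit Defensive.

Import Order.TTheory GRing.Theory Num.Theory.
Import numFieldNormedType.Exports.

Local Open Scope ring_scope.

(** * Iterated polynomials, index, degree and norm *)

(* Polynomials in m variables numbered 0, ..., m - 1; variable m - 1 is the
   outermost one. Multi-indices, degrees and points are functions on nat, of
   which only the values below m matter. *)
Fixpoint mpol (R : idomainType) (m : nat) : idomainType :=
  if m is m'.+1 then {poly mpol R m'} else R.

Fixpoint mconst (R : idomainType) (m : nat) : {rmorphism R -> mpol R m} :=
  if m is m'.+1 return {rmorphism R -> mpol R m}
  then (polyC \o mconst R m' : {rmorphism R -> {poly mpol R m'}}) else idfun.

(* The divided derivative of multi-order mu: dividing by factorials keeps integer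
   coefficients bounded exponentially in the degree. *)
Fixpoint hasse (R : idomainType) (m : nat) (mu : nat -> nat) : mpol R m -> mpol R m :=
  if m is m'.+1 return mpol R m -> mpol R m
  then fun P : {poly mpol R m'} => map_poly (hasse mu) P^`N(mu m') else id.

Fixpoint partial (R : idomainType) (m : nat) (h : nat) : mpol R m -> mpol R m :=
  if m is m'.+1 return mpol R m -> mpol R m
  then fun P : {poly mpol R m'} => if h == m' then P^`() else map_poly (partial h) P
  else fun=> 0.

(* P(X + xi), with the coefficients mapped by f. *)
Fixpoint taylor (R S : idomainType) (f : {rmorphism R -> S}) (xi : nat -> S) (m : nat)
    : {rmorphism mpol R m -> mpol S m} :=
  if m is m'.+1 return {rmorphism mpol R m -> mpol S m}
  then (comp_poly ('X + (mconst S m' (xi m'))%:P) \o map_poly (taylor f xi m')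
     : {rmorphism {poly mpol R m'} -> {poly mpol S m'}})
  else f.

(* All coefficients of weight < t vanish. Applied to [taylor f xi m P], this says
   that the index of P at xi for the weights w is at least t. *)
Fixpoint index_ge (F : realFieldType) (m : nat) (w : nat -> F) (t : F) : mpol F m -> Prop :=
  if m is m'.+1 return mpol F m -> Prop
  then fun P : {poly mpol F m'} => forall i, index_ge w (t - i%:R * w m') P`_i
  else fun c => c = 0 \/ t <= 0.

Fixpoint deg_le (R : idomainType) (m : nat) (r : nat -> nat) : mpol R m -> Prop :=
  if m is m'.+1 return mpol R m -> Prop
  then fun P : {poly mpol R m'} => (size P <= (r m').+1)%N /\ forall i, deg_le r P`_i
  else fun=> True.

Fixpoint l1norm (R : numDomainType) (m : nat) : mpol R m -> R :=
  if m is m'.+1 return mpol R m -> R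
  then fun P : {poly mpol R m'} => \sum_(i < size P) l1norm P`_i
  else fun c => `|c|.

Fixpoint mcoef (R : idomainType) (m : nat) (mu : nat -> nat) : mpol R m -> R :=
  if m is m'.+1 return mpol R m -> R
  then fun P : {poly mpol R m'} => mcoef mu P`_(mu m') else id.

Section Basics.
Variable R : idomainType.

Lemma hasse_ext m (mu nu : nat -> nat) (P : mpol R m) :
  (forall h, (h < m)%N -> mu h = nu h) -> hasse mu P = hasse nu P.
Proof.
elim: m P => [|m IH] P //= eq_mu; rewrite eq_mu //.
by apply: eq_map_poly => c; apply: IH => h hm; apply/eq_mu/ltnW.
Qed.

Lemma hasse_is_additive m mu : {morph @hasse R m mu : P Q / P + Q} /\ @hasse R m mu 0 = 0.
Proof.
elim: m => [|m [IHD IH0]] //=; split=> [P Q|]; apply/polyP => i.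
  by rewrite nderivnD coefD !coef_map_id0 // coefD IHD.
by rewrite coef_map_id0 // !(coef_nderivn, coef0) mul0rn.
Qed.

Lemma hasse0 m mu : @hasse R m mu 0 = 0. Proof. by case: (hasse_is_additive m mu). Qed.
Lemma hasseD m mu : {morph @hasse R m mu : P Q / P + Q}.
Proof. by case: (hasse_is_additive m mu). Qed.
Lemma hasseMn m mu n : {morph @hasse R m mu : P / P *+ n}.
Proof. by move=> P; elim: n => [|n IH]; rewrite ?mulr0n ?hasse0 // !mulrS hasseD IH. Qed.
Lemma hasseN m mu : {morph @hasse R m mu : P / - P}.
Proof. by move=> P; apply: (addrI (hasse mu P)); rewrite -hasseD !subrr hasse0. Qed.
Lemma hasseMz m mu n : {morph @hasse R m mu : P / P *~ n}.
Proof. by move=> P; case: n => n; rewrite /intmul ?hasseN hasseMn. Qed.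
Lemma hasse_sum m mu I (s : seq I) (f : I -> mpol R m) :
  hasse mu (\sum_(i <- s) f i) = \sum_(i <- s) hasse mu (f i).
Proof. exact: (big_morph _ (hasseD mu) (hasse0 m mu)). Qed.

Lemma coef_hasse m mu (P : {poly mpol R m}) i :
  (hasse mu (P : mpol R m.+1) : {poly mpol R m})`_i
    = hasse mu P`_(mu m + i) *+ 'C(mu m + i, mu m).
Proof. by rewrite /= coef_map_id0 ?hasse0 // coef_nderivn hasseMn. Qed.

Lemma hasseZ m mu c (P : mpol R m) : hasse mu (mconst R m c * P) = mconst R m c * hasse mu P.
Proof.
elim: m P => [|m IH] P //=; apply/polyP => i.
rewrite coefCM !coef_map_id0 ?hasse0 // !coef_nderivn coefCM -IH.
by rewrite mulrnAr.
Qed.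

Lemma partial_additive m h : {morph @partial R m h : P Q / P + Q} /\ @partial R m h 0 = 0.
Proof.
elim: m => [|m [IHD IH0]] /=; first by split=> // P Q; rewrite addr0.
case: ifP => _; first by split=> [P Q|]; rewrite ?derivD ?deriv0.
split=> [P Q|]; apply/polyP => i; last by rewrite coef_map_id0 // coef0.
by rewrite coefD !coef_map_id0 // coefD IHD.
Qed.

Lemma partial0 m h : @partial R m h 0 = 0. Proof. by case: (partial_additive m h). Qed.
Lemma partialD m h : {morph @partial R m h : P Q / P + Q}.
Proof. by case: (partial_additive m h). Qed.
Lemma partialMn m h n : {morph @partial R m h : P / P *+ n}.
Proof. by move=> P; elim: n => [|n IH]; rewrite ?mulr0n ?partial0 // !mulrS partialD IH. Qed.
Lemma partial_sum m h I (s : seq I) (f : I -> mpol R m) :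
  partial h (\sum_(i <- s) f i) = \sum_(i <- s) partial h (f i).
Proof. exact: (big_morph _ (partialD h) (partial0 m h)). Qed.

Lemma partialM m h (P Q : mpol R m) : partial h (P * Q) = partial h P * Q + P * partial h Q.
Proof.
elim: m P Q => [|m IH] P Q /=; first by rewrite mul0r mulr0 addr0.
case: ifP => _; first exact: derivM.
apply/polyP => i; rewrite coefD !(coefM, coef_map_id0) ?partial0 //.
rewrite (big_morph _ (partialD h) (partial0 m h)) -big_split /=.
by apply: eq_bigr => j _; rewrite IH !coef_map_id0 ?partial0.
Qed.

Definition incr (mu : nat -> nat) (h : nat) : nat -> nat :=
  fun x => if x == h then (mu h).+1 else mu x.

Lemma partial_hasse m h mu (P : mpol R m) : (h < m)%N ->
  partial h (hasse mu P) = hasse (incr mu h) P *+ (mu h).+1.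
Proof.
elim: m P => [|m IH] P // hm.
apply/polyP => i; rewrite coefMn coef_hasse /= /incr.
case: (eqVneq h m) => [->|hnm].
  rewrite coef_deriv coef_map_id0 ?hasse0 // coef_nderivn addnS hasseMn -!mulrnA.
  rewrite (@hasse_ext _ _ mu); last by move=> k /ltn_eqF->.
  rewrite addSn; congr (_ *+ _).
  by rewrite mulnC [RHS]mulnC mul_bin_left; congr (_ * _)%N; lia.
rewrite !coef_map_id0 ?hasse0 ?partial0 // coef_nderivn !hasseMn partialMn IH; last by lia.
by rewrite -!mulrnA mulnC.
Qed.

Lemma nderivn_shift (A : idomainType) (p : {poly A}) c n :
  (p \Po ('X + c%:P))^`N(n) = p^`N(n) \Po ('X + c%:P).
Proof.
elim/poly_ind: p n => [|p a IH] n.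
  by rewrite comp_poly0 (nderivn_poly0 (p := 0)) ?size_poly0 // comp_poly0.
case: n => [|n]; first by rewrite !nderivn0.
rewrite comp_poly_MXaddC [X in nderivn _ X](_ : _ = (p \Po ('X + c%:P)) * 'X + 0%:P
  + (c *: (p \Po ('X + c%:P)) + a%:P)); last first.
  by rewrite polyC0 addr0 -mul_polyC; ring.
rewrite nderivnD !nderivnMXaddC nderivnD nderivnZ nderivnC addr0 !IH.
by rewrite comp_polyD comp_polyM comp_polyX -mul_polyC; ring.
Qed.

Lemma map_hasse_shift m mu (P : {poly mpol R m}) x :
  map_poly (hasse mu) (P \Po ('X + (mconst R m x)%:P)) =
  map_poly (hasse mu) P \Po ('X + (mconst R m x)%:P).
Proof.
elim/poly_ind: P => [|P a IH]; first by rewrite comp_poly0 !map_poly0 comp_poly0.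
have hdpD (p q : {poly mpol R m}) : map_poly (hasse mu) (p + q) =
    map_poly (hasse mu) p + map_poly (hasse mu) q.
  by apply/polyP => i; rewrite coefD !coef_map_id0 ?hasse0 // coefD hasseD.
have hdpX (p : {poly mpol R m}) : map_poly (hasse mu) (p * 'X) = map_poly (hasse mu) p * 'X.
  by apply/polyP => i; rewrite coefMX !coef_map_id0 ?hasse0 // coefMX; case: ifP; rewrite ?hasse0.
have hdpC (c : mpol R m) : map_poly (hasse mu) c%:P = (hasse mu c)%:P.
  by apply/polyP => i; rewrite coefC !coef_map_id0 ?hasse0 // coefC; case: ifP; rewrite ?hasse0.
rewrite comp_poly_MXaddC mulrDr !hdpD !hdpX hdpC comp_poly_MXaddC mulrDr -IH.
congr (_ + _ + _); apply/polyP => i.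
by rewrite coefMC !coef_map_id0 ?hasse0 // coefMC mulrC hasseZ mulrC.
Qed.

Lemma hasse_shift m mu (P : {poly mpol R m}) x :
  (hasse mu ((P \Po ('X + (mconst R m x)%:P)) : mpol R m.+1) : {poly mpol R m}) =
  (hasse mu (P : mpol R m.+1) : {poly mpol R m}) \Po ('X + (mconst R m x)%:P).
Proof. by rewrite /= nderivn_shift map_hasse_shift. Qed.

End Basics.

Section Taylor.
Variables (R S : idomainType) (f : {rmorphism R -> S}) (xi : nat -> S).

Lemma coef_map_taylor m (p : {poly mpol R m}) i :
  (map_poly (taylor f xi m) p)`_i = taylor f xi m p`_i.
Proof. by rewrite coef_map_id0 ?rmorph0. Qed.

Lemma taylor_mconst m c : taylor f xi m (mconst R m c) = mconst S m (f c).
Proof. by elim: m => [|m IH] //=; rewrite map_polyC /= comp_polyC IH. Qed.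

Lemma taylor_hasse m mu (P : mpol R m) : taylor f xi m (hasse mu P) = hasse mu (taylor f xi m P).
Proof.
elim: m P => [|m IH] P //.
rewrite [LHS]/= [X in _ = hasse mu X]/= [RHS]hasse_shift /=; congr (_ \Po _).
rewrite nderivn_map; apply/polyP => i.
by rewrite coef_map_taylor !coef_map_id0 ?hasse0 ?rmorph0 // IH.
Qed.

End Taylor.

Lemma taylor_taylor (R S T : idomainType) (f : {rmorphism R -> S}) (g : {rmorphism S -> T})
    (h : {rmorphism R -> T}) (xi : nat -> S) (eta zeta : nat -> T) m (P : mpol R m) :
  (forall c, h c = g (f c)) -> (forall i, zeta i = g (xi i) + eta i) ->
  taylor g eta m (taylor f xi m P) = taylor h zeta m P.
Proof.
move=> hE zE; elim: m P => [|m IH] P /=; first by rewrite hE.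
rewrite map_comp_poly -comp_polyA rmorphD /= map_polyX map_polyC /=.
congr (_ \Po _); last by apply/polyP => i; rewrite !coef_map_taylor IH.
by rewrite comp_polyD comp_polyX comp_polyC taylor_mconst zE rmorphD polyCD -addrA [X in _ + X]addrC.
Qed.

Section Order.
Variable F : realFieldType.
Implicit Types (w : nat -> F) (t u : F).

Lemma index_ge_le0 m w t (P : mpol F m) : (forall h, (h < m)%N -> 0 <= w h) -> t <= 0 -> index_ge w t P.
Proof.
elim: m t P => [|m IH] t P /= w0 t0; first by right.
move=> i; apply: IH => [h hm|]; first exact/w0/ltnW.
by rewrite subr_le0 (le_trans t0) // mulr_ge0 ?ler0n ?w0.
Qed.

Lemma index_ge_mono m w t u (P : mpol F m) : u <= t -> index_ge w t P -> index_ge w u P.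
Proof.
elim: m t u P => [|m IH] t u P /= ut; first by move=> [->|t0]; [left|right; apply: le_trans t0].
by move=> H i; apply: IH (H i); rewrite lerD2r.
Qed.

Lemma index_ge0 m w t : @index_ge F m w t 0.
Proof. by elim: m t => [|m IH] t /=; [left | move=> i; rewrite coef0]. Qed.

Lemma index_geD m w t (P Q : mpol F m) : index_ge w t P -> index_ge w t Q -> index_ge w t (P + Q).
Proof.
elim: m t P Q => [|m IH] t P Q /=; last by move=> HP HQ i; rewrite coefD; apply: IH.
by move=> [->|] //; [rewrite add0r | right].
Qed.

Lemma index_geN m w t (P : mpol F m) : index_ge w t P -> index_ge w t (- P).
Proof.
elim: m t P => [|m IH] t P /=; last by move=> HP i; rewrite coefN; apply: IH.
by move=> [->|]; [left; rewrite oppr0 | right].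
Qed.

Lemma index_geMn m w t n (P : mpol F m) : index_ge w t P -> index_ge w t (P *+ n).
Proof.
move=> HP; elim: n => [|n IH]; first by rewrite mulr0n; apply: index_ge0.
by rewrite mulrS; apply: index_geD.
Qed.

Lemma index_ge_sum m w t I (s : seq I) (p : pred I) (f : I -> mpol F m) :
  (forall i, p i -> index_ge w t (f i)) -> index_ge w t (\sum_(i <- s | p i) f i).
Proof.
move=> H; elim/big_rec: _ => [|i x pi]; first exact: index_ge0.
by apply: index_geD; apply: H.
Qed.

Lemma index_geM m w t u (P Q : mpol F m) : index_ge w t P -> index_ge w u Q -> index_ge w (t + u) (P * Q).
Proof.
elim: m t u P Q => [|m IH] t u P Q /=.
  move=> [->|t0]; first by left; rewrite mul0r.
  move=> [->|u0]; first by left; rewrite mulr0.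
  by right; lra.
move=> HP HQ i; rewrite coefM; apply: index_ge_sum => j _.
apply: index_ge_mono (IH _ _ _ _ (HP j) (HQ (i - j)%N)).
rewrite natrB; first by lra.
by have := ltn_ord j; lia.
Qed.

Lemma index_ge1 m w : @index_ge F m w 0 1.
Proof.
elim: m => [|m IH] /=; first by right.
move=> i; rewrite coef1; case: i => [|i] /=; first by rewrite mul0r subr0.
exact: index_ge0.
Qed.

Lemma index_ge_prod m w I (s : seq I) (t : I -> F) (f : I -> mpol F m) :
  (forall i, index_ge w (t i) (f i)) -> index_ge w (\sum_(i <- s) t i) (\prod_(i <- s) f i).
Proof.
move=> H; elim: s => [|i s IH]; first by rewrite !big_nil; apply: index_ge1.
by rewrite !big_cons; apply: index_geM.
Qed.

Lemma index_ge_det m w n (t : 'I_n -> F) (M : 'M[mpol F m]_n) :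
  (forall i j, index_ge w (t j) (M i j)) -> index_ge w (\sum_j t j) (\det M).
Proof.
move=> H; rewrite /determinant; apply: index_ge_sum => s _.
have: index_ge w (\sum_j t j) (\prod_i M i (s i)).
  rewrite (reindex_inj (@perm_inj _ s)) /=.
  exact: index_ge_prod.
by rewrite -signr_odd; case: (odd _); rewrite ?expr0 ?mul1r // expr1 mulN1r; apply: index_geN.
Qed.

Lemma index_ge_mconstM m w t c (P : mpol F m) : c != 0 -> index_ge w t (mconst F m c * P) -> index_ge w t P.
Proof.
move=> c0; elim: m t P => [|m IH] t P /=; last by move=> H i; apply: IH; rewrite -coefCM.
move=> [/eqP|]; last by right.
by rewrite mulf_eq0 (negbTE c0) /= => /eqP; left.
Qed.

Lemma index_ge_scale m w a t (P : mpol F m) : 0 < a ->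
  index_ge w (a * t) P -> index_ge (fun h => a^-1 * w h) t P.
Proof.
move=> a0; elim: m t P => [|m IH] t P /=.
  by move=> [->|]; [left | rewrite pmulr_rle0 //; right].
move=> H i; apply: IH; have := H i; rewrite mulrBr.
by rewrite [a * (_ * _)](_ : _ = i%:R * w m) //; field; lra.
Qed.

Lemma index_ge_hasse m w t (mu : nat -> nat) (P : mpol F m) :
  index_ge w t P -> index_ge w (t - \sum_(h < m) (mu h)%:R * w h) (hasse mu P).
Proof.
elim: m t P => [|m IH] t P; first by rewrite big_ord0 subr0.
move=> H i; rewrite coef_hasse; apply: index_geMn; apply: index_ge_mono (IH _ _ (H (mu m + i)%N)).
by rewrite big_ord_recr /= natrD; lra.
Qed.

End Order.

Section Degree.
Variable R : idomainType.
Implicit Types r s : nat -> nat.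

Lemma deg_le0 m r : @deg_le R m r 0.
Proof. by elim: m => [|m IH] //=; split=> [|i]; rewrite ?size_poly0 ?coef0. Qed.

Lemma deg_le_mono m r s (P : mpol R m) : (forall h, (h < m)%N -> (r h <= s h)%N) -> deg_le r P -> deg_le s P.
Proof.
elim: m P => [|m IH] P //= rs [sP cP]; split; first by rewrite (leq_trans sP) // ltnS rs.
by move=> i; apply: IH (cP i) => h hm; apply/rs/ltnW.
Qed.

Lemma deg_leD m r (P Q : mpol R m) : deg_le r P -> deg_le r Q -> deg_le r (P + Q).
Proof.
elim: m P Q => [|m IH] P Q //= [sP cP] [sQ cQ]; split=> [|i]; last by rewrite coefD; apply: IH.
by rewrite (leq_trans (size_polyD _ _)) // geq_max sP.
Qed.

Lemma deg_leN m r (P : mpol R m) : deg_le r P -> deg_le r (- P).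
Proof.
by elim: m P => [|m IH] P //= [sP cP]; split=> [|i]; rewrite ?size_polyN // coefN; apply: IH.
Qed.

Lemma deg_leMn m r n (P : mpol R m) : deg_le r P -> deg_le r (P *+ n).
Proof.
move=> HP; elim: n => [|n IH]; first by rewrite mulr0n; apply: deg_le0.
by rewrite mulrS; apply: deg_leD.
Qed.

Lemma deg_le_sum m r I (q : seq I) (p : pred I) (f : I -> mpol R m) :
  (forall i, p i -> deg_le r (f i)) -> deg_le r (\sum_(i <- q | p i) f i).
Proof.
move=> H; elim/big_rec: _ => [|i x pi]; first exact: deg_le0.
by apply: deg_leD; apply: H.
Qed.

Lemma deg_leM m r s (P Q : mpol R m) : deg_le r P -> deg_le s Q -> deg_le (fun h => r h + s h)%N (P * Q).
Proof.
elim: m P Q => [|m IH] P Q //= [sP cP] [sQ cQ]; split=> [|i].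
  by rewrite (leq_trans (size_polyMleq _ _)) // -subn1 leq_subLR (leq_trans (leq_add sP sQ)) //; lia.
by rewrite coefM; apply: deg_le_sum => j _; apply: IH.
Qed.

Lemma deg_le1 m r : @deg_le R m r 1.
Proof.
elim: m => [|m IH] //=; split=> [|i]; first by rewrite size_poly1.
by rewrite coef1; case: i => [|i] //=; apply: deg_le0.
Qed.

Lemma deg_le_det m r n (M : 'M[mpol R m]_n) :
  (forall i j, deg_le r (M i j)) -> deg_le (fun h => n * r h)%N (\det M).
Proof.
move=> H; rewrite /determinant; apply: deg_le_sum => s _.
have: deg_le (fun h => n * r h)%N (\prod_i M i (s i)).
  rewrite -{1}(size_enum_ord n) -big_enum /=.
  elim: (enum 'I_n) => [|i q IH] /=; first by rewrite big_nil; apply: deg_le1.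
  rewrite big_cons; apply: deg_le_mono (deg_leM (H _ _) IH) => h hm.
  by rewrite mulSn.
by rewrite -signr_odd; case: (odd _); rewrite ?expr0 ?mul1r // expr1 mulN1r; apply: deg_leN.
Qed.

Lemma deg_le_hasse m r mu (P : mpol R m) : deg_le r P -> deg_le r (hasse mu P).
Proof.
elim: m P => [|m IH] P // [sP cP]; split=> [|i]; last first.
  by rewrite coef_hasse; apply: deg_leMn; apply: IH; apply: cP.
apply: leq_trans (size_poly _ _) (leq_trans (size_poly _ _) _).
by rewrite (leq_trans _ sP) // leq_subr.
Qed.

End Degree.

Section Norm.
Variable R : numDomainType.

Lemma l1norm_ge0 m (P : mpol R m) : 0 <= l1norm P.
Proof. by elim: m P => [|m IH] P //=; apply: sumr_ge0. Qed.

Lemma l1norm0 m : @l1norm R m 0 = 0.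
Proof. by case: m => [|m] /=; rewrite ?normr0 // size_poly0 big_ord0. Qed.

Lemma l1norm_eq0 m (P : mpol R m) : l1norm P = 0 -> P = 0.
Proof.
elim: m P => [|m IH] P /=; first by move/eqP; rewrite normr_eq0 => /eqP.
move=> /eqP; rewrite psumr_eq0 => [/allP H|i _]; last exact: l1norm_ge0.
apply/polyP => i; rewrite coef0; case: (ltnP i (size P)) => iP; last by rewrite nth_default.
by apply: IH; apply/eqP/(H (Ordinal iP)); rewrite mem_index_enum.
Qed.

Lemma l1norm_widen m n (P : {poly mpol R m}) : (size P <= n)%N ->
  l1norm (P : mpol R m.+1) = \sum_(i < n) l1norm P`_i.
Proof.
move=> sP /=; rewrite (big_ord_widen n (fun i => l1norm P`_i) sP) big_mkcond /=.
apply: eq_bigr => i _; case: ifPn => //; rewrite -leqNgt => iP.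
by rewrite nth_default // l1norm0.
Qed.

Lemma l1normD m (P Q : mpol R m) : l1norm (P + Q) <= l1norm P + l1norm Q.
Proof.
elim: m P Q => [|m IH] P Q; first exact: ler_normD.
pose n := maxn (size P) (size Q).
rewrite (@l1norm_widen _ n P) ?leq_maxl // (@l1norm_widen _ n Q) ?leq_maxr //.
rewrite (@l1norm_widen _ n) ?size_polyD // -big_split /=.
by apply: ler_sum => i _; rewrite coefD.
Qed.

Lemma l1normN m (P : mpol R m) : l1norm (- P) = l1norm P.
Proof.
elim: m P => [|m IH] P /=; first by rewrite normrN.
by rewrite size_polyN; apply: eq_bigr => i _; rewrite coefN.
Qed.

Lemma l1norm_sum m I (s : seq I) (p : pred I) (f : I -> mpol R m) :
  l1norm (\sum_(i <- s | p i) f i) <= \sum_(i <- s | p i) l1norm (f i).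
Proof.
elim/big_rec2: _ => [|i x y pi H]; first by rewrite l1norm0.
by apply: le_trans (l1normD _ _) _; rewrite lerD2l.
Qed.

Lemma l1normMn m (P : mpol R m) n : l1norm (P *+ n) = l1norm P *+ n.
Proof.
elim: m P n => [|m IH] P n; first by rewrite /= normrMn.
rewrite (@l1norm_widen _ (size P) (P *+ n)); last first.
  by apply/leq_sizeP => j Pj; rewrite coefMn nth_default // mul0rn.
by rewrite -sumrMnl; apply: eq_bigr => i _; rewrite coefMn IH.
Qed.

Lemma l1norm_coef m (P : {poly mpol R m}) i : l1norm P`_i <= l1norm (P : mpol R m.+1).
Proof.
case: (ltnP i (size P)) => iP; last by rewrite nth_default // l1norm0 l1norm_ge0.
rewrite /= (bigD1 (Ordinal iP)) //= lerDl; apply: sumr_ge0 => j _; exact: l1norm_ge0.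
Qed.

Lemma l1normC m (c : mpol R m) : l1norm (c%:P : mpol R m.+1) = l1norm c.
Proof.
rewrite (@l1norm_widen _ 1) ?size_polyC_leq1 // big_ord1 coefC //.
Qed.

Lemma l1normXn m n (P : {poly mpol R m}) : l1norm (P * 'X^n : mpol R m.+1) = l1norm (P : mpol R m.+1).
Proof.
rewrite (@l1norm_widen _ (n + size P)); last first.
  by apply/leq_sizeP => j jP; rewrite coefMXn; case: ltnP => [_|nj]; rewrite ?l1norm0 //
    nth_default // -(leq_add2l n) subnKC.
rewrite big_split_ord /= big1 ?add0r => [|i _]; last by rewrite coefMXn ltn_ord l1norm0.
by apply: eq_bigr => i _; rewrite coefMXn ltnNge leq_addr /= addKn.
Qed.

Lemma l1normM m (P Q : mpol R m) : l1norm (P * Q) <= l1norm P * l1norm Q.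
Proof.
elim: m P Q => [|m IH]; first by move=> P Q; rewrite /= normrM.
move=> P Q; change {poly mpol R m} in P, Q.
have CM (c : mpol R m) : @l1norm R m.+1 (c%:P * Q) <= l1norm c * @l1norm R m.+1 Q.
  rewrite (@l1norm_widen _ (size Q)); last first.
    by apply/leq_sizeP => j jQ; rewrite coefCM nth_default // mulr0.
  by rewrite [@l1norm _ m.+1 Q]/= mulr_sumr; apply: ler_sum => i _; rewrite coefCM.
have -> : P * Q = \sum_(i < size P) (P`_i)%:P * Q * 'X^i.
  rewrite -{1}[P](@coefK (mpol R m)) poly_def mulr_suml; apply: eq_bigr => i _.
  by rewrite -mul_polyC -mulrA [_ * Q]mulrC mulrA.
apply: le_trans (l1norm_sum (m:=m.+1) _ _ _) _; rewrite [@l1norm _ m.+1 P]/= mulr_suml.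
by apply: ler_sum => i _; rewrite l1normXn.
Qed.

Lemma l1norm1 m : @l1norm R m 1 = 1.
Proof. by elim: m => [|m IH]; [rewrite /= normr1 | rewrite -[1]/(1%:P) l1normC]. Qed.

Lemma l1norm_det m n b (M : 'M[mpol R m]_n) :
  (forall i j, l1norm (M i j) <= b) -> l1norm (\det M) <= n`!%:R * b ^+ n.
Proof.
move=> H; rewrite /determinant; apply: le_trans (l1norm_sum _ _ _) _.
have -> : n`!%:R * b ^+ n = \sum_(s : 'S_n) b ^+ n.
  by rewrite sumr_const card_Sn mulr_natl.
apply: ler_sum => s _.
have: l1norm (\prod_i M i (s i)) <= b ^+ n.
  rewrite -[X in _ <= _ ^+ X](size_enum_ord n) -big_enum /=.
  elim: (enum 'I_n) => [|i q IH] /=; first by rewrite big_nil l1norm1.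
  rewrite big_cons exprS; apply: le_trans (l1normM _ _) _.
  by apply: ler_pM; rewrite ?l1norm_ge0.
by rewrite -signr_odd; case: (odd _); rewrite ?expr0 ?mul1r // expr1 mulN1r l1normN.
Qed.

Lemma l1norm_hasse m (r mu : nat -> nat) (P : mpol R m) : deg_le r P ->
  l1norm (hasse mu P) <= 2 ^+ (\sum_(h < m) r h) * l1norm P.
Proof.
elim: m P => [|m IH] P; first by rewrite big_ord0 mul1r.
move=> [sP cP]; have [sH _] := @deg_le_hasse _ m.+1 r mu P (conj sP cP).
rewrite (l1norm_widen sH).
rewrite (@l1norm_widen m (mu m + (r m).+1) P); last by rewrite (leq_trans sP) // leq_addl.
rewrite big_split_ord /= mulrDr mulr_sumr -[X in X <= _]add0r lerD //.
  by apply: sumr_ge0 => i _; rewrite mulr_ge0 ?exprn_ge0 ?l1norm_ge0.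
rewrite mulr_sumr; apply: ler_sum => i _; rewrite coef_hasse l1normMn.
rewrite big_ord_recr exprD /= [2 ^+ _ * _]mulrC -mulrA.
case: (leqP (mu m + i) (r m)) => le_r; last first.
  by rewrite nth_default ?(leq_trans sP) // hasse0 l1norm0 mul0rn !mulr0.
rewrite -[X in X <= _]mulr_natl; apply: ler_pM; rewrite ?ler0n ?l1norm_ge0 //; last exact: IH (cP _).
rewrite -natrX ler_nat (leq_trans _ (leq_pexp2l _ le_r)) //.
rewrite -[X in (_ <= X ^ _)%N]/(1 + 1)%N expnDn.
rewrite (bigD1 (inord (mu m) : 'I_(mu m + i).+1)) //= inordK ?ltnS ?leq_addr //.
by rewrite !exp1n !muln1 leq_addr.
Qed.

End Norm.

(** * Generalized Wronskians *)

Section Wronskian.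

Lemma mpol_mulrz_eq0 m (P : mpol int m) a : P *~ a = 0 -> a = 0 \/ P = 0.
Proof.
have H n : P *+ n.+1 = 0 -> P = 0.
  move=> /(congr1 (@l1norm int m)); rewrite l1normMn l1norm0 => /eqP.
  by rewrite mulrn_eq0 => /eqP/l1norm_eq0.
case: a => [[|n]|n]; rewrite /intmul; [by left | by move=> /H; right |].
by move/eqP; rewrite oppr_eq0 => /eqP/H; right.
Qed.

Definition indep m n (f : 'I_n -> mpol int m) :=
  forall a : 'I_n -> int, \sum_i f i *~ a i = 0 -> forall i, a i = 0.

Lemma coefM_top (A : nzRingType) (p q : {poly A}) n :
  (size p <= n.+1)%N -> (size q <= n.+1)%N -> (p * q)`_(n + n) = p`_n * q`_n.
Proof.
move=> sp sq; rewrite coefM.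
have nn : (n < (n + n).+1)%N by rewrite ltnS leq_addr.
rewrite (bigD1 (Ordinal nn)) //= addnK big1 ?addr0 // => i ne.
have {}ne : (i != n :> nat)%N by [].
case: (ltnP n i) => ni; first by rewrite nth_default ?mul0r // (leq_trans sp).
by rewrite [q`__]nth_default ?mulr0 // (leq_trans sq) //; lia.
Qed.

Lemma deriv_proportional (A : idomainType) (p q : {poly A}) :
  (forall n (c : A), c *+ n.+1 = 0 -> c = 0) ->
  p != 0 -> q != 0 -> p^`() * q = p * q^`() ->
  size p = size q /\ lead_coef q *: p = lead_coef p *: q.
Proof.
move=> char0.
have sz (u v : {poly A}) : u != 0 -> v != 0 -> u^`() * v = u * v^`() -> (size u <= size v)%N.
  move=> u0 v0 uv; rewrite leqNgt; apply/negP => lt_vu.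
  move: (u0) (v0); rewrite -!size_poly_gt0.
  case Eu: (size u) lt_vu => [//|a]; case Ev: (size v) => [//|b] lt_ba _ _.
  have lu : u`_a != 0 by rewrite -[a]/(a.+1.-1) -Eu -lead_coefE lead_coef_eq0.
  have lv : v`_b != 0 by rewrite -[b]/(b.+1.-1) -Ev -lead_coefE lead_coef_eq0.
  have zv i : (b < i)%N -> v`_i = 0 by move=> bi; rewrite nth_default // Ev.
  have zu i : (a < i)%N -> u`_i = 0 by move=> bi; rewrite nth_default // Eu.
  case: a {Eu} lt_ba lu zu => [|a]; first by rewrite ltnS.
  move=> lt_ba lu zu.
  have := congr1 (fun w : {poly A} => w`_(a + b)) uv.
  rewrite /= !coefM.
  have ab : (a < (a + b).+1)%N by lia.
  rewrite (bigD1 (Ordinal ab)) //= big1 => [|i ne]; last first.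
    have {}ne : (i != a :> nat)%N by [].
    rewrite coef_deriv; case: (ltnP a i) => ai.
      by rewrite zu ?mul0rn ?mul0r //; lia.
    by rewrite zv ?mulr0 //; have := ltn_ord i; lia.
  have -> : (a + b - a = b)%N by lia.
  rewrite addr0 coef_deriv.
  have [ba|ab'] := ltnP a.+1 (a + b).+1.
    rewrite (bigD1 (Ordinal ba)) //= big1 => [|i ne]; last first.
      have {}ne : (i != a.+1 :> nat)%N by [].
      rewrite coef_deriv; case: (ltnP a.+1 i) => ai.
        by rewrite zu ?mul0r //; lia.
      by rewrite zv ?mul0rn ?mulr0 //; have := ltn_ord i; lia.
    rewrite addr0 coef_deriv.
    have -> : ((a + b - a.+1).+1 = b)%N by lia.
    rewrite mulrnAl mulrnAr => /eqP; rewrite -subr_eq0 -mulrnBr; last by lia.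
    have -> : (a.+1 - b = (a - b).+1)%N by lia.
    by move/eqP/char0/eqP; rewrite mulf_eq0 (negbTE lu) (negbTE lv).
  have b0 : b = 0%N by lia.
  rewrite big1 => [|i _].
    by rewrite mulrnAl => /char0/eqP; rewrite mulf_eq0 (negbTE lu) (negbTE lv).
  by rewrite coef_deriv zv ?mul0rn ?mulr0 //; lia.
move=> p0 q0 pq.
have szE : size p = size q.
  by apply/eqP; rewrite eqn_leq !sz // mulrC -pq mulrC.
split=> //; apply/eqP; rewrite -subr_eq0; apply: contraT => w0.
set w := _ - _ in w0.
have wq : w^`() * q = w * q^`().
  by rewrite /w derivB !derivZ !mulrBl -!scalerAl pq [q^`() * q]mulrC.
have: (size q <= size w)%N by apply: sz; rewrite // [RHS]mulrC wq mulrC.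
rewrite leqNgt => /negP[].
have : (size w <= (size q).-1)%N.
  apply/leq_sizeP => j; rewrite leq_eqVlt => /orP[/eqP <-|lt].
    by rewrite coefB !coefZ -{1}szE -!lead_coefE mulrC subrr.
  have qj : (size q <= j)%N by rewrite -(@prednK (size q)) // size_poly_gt0.
  by rewrite coefB !coefZ !nth_default ?mulr0 ?subr0 // szE.
by move/leq_ltn_trans; apply; rewrite prednK // size_poly_gt0.
Qed.

Lemma partial_proportional m (P Q : mpol int m) : Q != 0 ->
  (forall h, (h < m)%N -> partial h P * Q = P * partial h Q) ->
  exists a b : int, b != 0 /\ P *~ b = Q *~ a.
Proof.
elim: m P Q => [|m IH] P Q Q0 H.
  by exists P, Q; split=> //; rewrite /= -mulrzr -[RHS]mulrzr !intz mulrC.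
change {poly mpol int m} in P, Q.
have [->|P0] := eqVneq P 0; first by exists 0, 1; rewrite mulr0z mul0rz.
have tf n (c : mpol int m) : c *+ n.+1 = 0 -> c = 0.
  by move=> /(@mpol_mulrz_eq0 m c n.+1) [].
have := H m (ltnSn m); rewrite /= eqxx => /(deriv_proportional tf P0 Q0) [szE prop].
have lQ0 : lead_coef Q != 0 by rewrite lead_coef_eq0.
have [h hm|a [b [b0 ab]]] := IH (lead_coef P) _ lQ0.
  have := H h (ltnW hm); rewrite /= (ltn_eqF hm).
  move=> /(congr1 (fun w : {poly mpol int m} => w`_((size Q).-1 + (size Q).-1))).
  have Qs : (size Q).-1.+1 = size Q by rewrite prednK // size_poly_gt0.
  rewrite /= !coefM_top ?Qs ?szE ?size_poly //.
    by rewrite !coef_map_id0 ?partial0 // -{1 3}szE -!lead_coefE.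
  - by rewrite -szE size_poly.
exists a, b; split=> //; apply: (@mulfI {poly mpol int m} (lead_coef Q)%:P).
  by rewrite polyC_eq0.
rewrite !mulrzAr !mul_polyC prop -!mul_polyC -!mulrzAl.
by rewrite -!(rmorphMz (polyC : {rmorphism _ -> _})) /= ab.
Qed.

Definition multideg (m : nat) (mu : nat -> nat) := (\sum_(h < m) mu h)%N.

Lemma multideg_incr m mu h : (h < m)%N -> multideg m (incr mu h) = (multideg m mu).+1.
Proof.
move=> hm; rewrite /multideg (bigD1 (Ordinal hm)) //= [in RHS](bigD1 (Ordinal hm)) //=.
rewrite /incr eqxx addSn; congr (_ + _).+1; apply: eq_bigr => i ne.
by case: eqP => // E; case/eqP: ne; apply/val_inj.
Qed.

Lemma hasse_const m (P : mpol int m) : hasse (fun=> 0%N) P = P.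
Proof.
elim: m P => [|m IH] P //; apply/polyP => i.
by rewrite coef_hasse IH bin0.
Qed.

(* Differentiating the relations and eliminating one g l0 shows that all
   g l / g l0 are constant, which contradicts the independence of f. *)
Lemma wronskian_ker m n (f g : 'I_n -> mpol int m) : indep f ->
  (forall mu, (multideg m mu < n)%N -> \sum_l g l * hasse mu (f l) = 0) ->
  forall l, g l = 0.
Proof.
elim: n f g => [|n IH] f g f_ind H; first by case.
move=> l0; apply/eqP; apply: contraT => g0.
have f'_ind : indep (f \o lift l0).
  move=> a Ha i.
  have := f_ind (fun j => if unlift l0 j is Some k then a k else 0).
  rewrite (bigD1_ord l0) //= unlift_none mulr0z add0r.
  under eq_bigr do rewrite liftK.
  by move=> /(_ Ha (lift l0 i)); rewrite liftK.
have prop h : (h < m)%N -> forall l, partial h (g l) * g l0 = g l * partial h (g l0).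
  move=> hm l.
  pose G l := partial h (g l) * g l0 - g l * partial h (g l0).
  have G0 : G l0 = 0 by rewrite /G mulrC subrr.
  suff : forall l, G l = 0 by move=> /(_ l)/eqP; rewrite subr_eq0 => /eqP.
  have GH mu : (multideg m mu < n)%N -> \sum_l G l * hasse mu (f l) = 0.
    move=> mun; have H1 := H mu (leqW mun).
    have H2 := H (incr mu h); rewrite multideg_incr // ltnS in H2.
    have := congr1 (@partial int m h) H1; rewrite partial_sum partial0.
    under eq_bigr do rewrite partialM partial_hasse // mulrnAr.
    rewrite big_split /= sumrMnl H2 // mul0rn addr0 => H3.
    have -> : \sum_l G l * hasse mu (f l) = \sum_l (g l0 * (partial h (g l) * hasse mu (f l))
        - partial h (g l0) * (g l * hasse mu (f l))).
      by apply: eq_bigr => l' _; rewrite /G; ring.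
    by rewrite sumrB -!mulr_sumr H3 H1 !mulr0 subrr.
  move=> j; case: (unliftP l0 j) => [k ->|->] //.
  apply: (IH (f \o lift l0) (G \o lift l0)) => // mu /GH.
  by rewrite (bigD1_ord l0) //= G0 mul0r add0r.
have ex l : exists ab : int * int, (ab.2 != 0) && (g l *~ ab.2 == g l0 *~ ab.1).
  have [a [b [b0 E]]] := partial_proportional g0 (fun h hm => prop h hm l).
  by exists (a, b); rewrite /= b0 E eqxx.
pose B l := (xchoose (ex l)).2; pose A l := (xchoose (ex l)).1.
have B0 l : B l != 0 by have /andP[] := xchooseP (ex l).
have AB l : g l *~ B l = g l0 *~ A l by have /andP[_ /eqP] := xchooseP (ex l).
have := f_ind (fun l => A l * \prod_(j | j != l) B j) _ l0.
have AB0 : A l0 = B l0.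
  apply/eqP; rewrite -subr_eq0; apply/eqP.
  have : g l0 *~ (A l0 - B l0) = 0 by rewrite mulrzBr AB subrr.
  by move=> /mpol_mulrz_eq0[//|g00]; rewrite g00 eqxx in g0.
have -> : A l0 * \prod_(j | j != l0) B j = \prod_j B j.
  by rewrite AB0 [RHS](bigD1 l0).
suff -> : \sum_l f l *~ (A l * \prod_(j | j != l) B j) = 0.
  move=> /(_ erefl)/eqP; apply: contraLR => _.
  by apply/prodf_neq0 => j _.
have H0 : \sum_l g l * f l = 0.
  rewrite -[RHS](H (fun=> 0%N)); last by rewrite /multideg big1.
  by apply: eq_bigr => l _; rewrite hasse_const.
have {H0} : (\sum_l g l * f l) *~ \prod_j B j = 0 by rewrite H0 mul0rz.
rewrite mulrz_suml => H0; apply: (mulfI g0); rewrite mulr0 -[RHS]H0 mulr_sumr.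
apply: eq_bigr => l _; rewrite [in RHS](bigD1 l) //= mulrzAr !mulrzA.
by rewrite -!mulrzAl AB.
Qed.
End Wronskian.

Section Decomposition.

Lemma wronskian_exists m n (f : 'I_n -> mpol int m) : indep f ->
  exists mu : 'I_n -> nat -> nat, (forall i, (multideg m (mu i) < n)%N) /\
    \det (\matrix_(i, l) hasse (mu i) (f l)) != 0.
Proof.
elim: n f => [|n IH] f f_ind; first by exists (fun _ _ => 0%N); split=> [[]|] //; rewrite det_mx00 oner_eq0.
have f'_ind : indep (f \o lift ord_max).
  move=> a Ha i.
  have := f_ind (fun j => if unlift ord_max j is Some k then a k else 0).
  rewrite (bigD1_ord ord_max) //= unlift_none mulr0z add0r.
  under eq_bigr do rewrite liftK.
  by move=> /(_ Ha (lift ord_max i)); rewrite liftK.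
have [mu [mun det0]] := IH _ f'_ind.
pose nu (v : nat -> nat) i := if unlift ord_max i is Some k then mu k else v.
pose M v : 'M[mpol int m]_n.+1 := \matrix_(i, l) hasse (nu v i) (f l).
have [[v vn Mv]|no] := pselect (exists2 v, (multideg m v < n.+1)%N & \det (M v) != 0).
  exists (nu v); split=> // i; rewrite /nu; case: unliftP => //= k _.
  exact: leqW.
have M0 v : (multideg m v < n.+1)%N -> \det (M v) = 0.
  by move=> vn; apply/eqP; apply: contraT => Mv; case: no; exists v.
pose g l := cofactor (M (fun=> 0%N)) ord_max l.
have gE v l : cofactor (M v) ord_max l = g l.
  rewrite /g /cofactor; congr (_ * \det _); apply/matrixP => i j.
  by rewrite !mxE /nu liftK.
have /wronskian_ker : indep f by [].
move=> /(_ g _ ord_max) H; case/eqP: det0.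
have /eqP : g ord_max = 0.
  apply: H => v vn; rewrite -[RHS](M0 v vn) (expand_det_row _ ord_max).
  by apply: eq_bigr => l _; rewrite gE mxE /nu unlift_none mulrC.
rewrite /g /cofactor mulf_eq0 signr_eq0 /= => /eqP <-; congr (\det _).
by apply/matrixP => i j; rewrite !mxE /nu liftK.
Qed.

Lemma wronskian1 n (g : 'I_n -> {poly int}) : indep (g : 'I_n -> mpol int 1) ->
  \det (\matrix_(l < n, j < n) (g l)^`N(j)) != 0.
Proof.
move=> g_ind; apply/negP => /det0P[v v0 vM]; case/eqP: v0.
apply/rowP => l; rewrite mxE.
apply: (@wronskian_ker 1 n g (fun l => v 0 l) g_ind) => mu.
rewrite /multideg big_ord1 => mun.
have := congr1 (fun A : 'rV_n => A 0 (Ordinal mun)) vM.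
rewrite !mxE => E; rewrite -[RHS]E; apply: eq_bigr => i _.
by rewrite mxE; congr (_ * _); apply/polyP => k; rewrite /= coef_map_id0.
Qed.

Lemma nindep_exists m n (f : 'I_n -> mpol int m) : ~ indep f ->
  exists (a : 'I_n -> int) l, \sum_i f i *~ a i = 0 /\ a l != 0.
Proof.
move=> /existsNP[a /not_implyP[fa /existsNP[l /eqP al]]].
by exists a, l.
Qed.

Definition decomp m (P : {poly mpol int m}) (c : int) n (f : 'I_n -> mpol int m)
    (g : 'I_n -> {poly int}) :=
  P *~ c = \sum_l (f l)%:P * map_poly (mconst int m) (g l).

Lemma eliminate_term (A : comNzRingType) n (F G : 'I_n.+1 -> A) (a : 'I_n.+1 -> int) l :
  \sum_i F i *~ a i = 0 ->
  (\sum_i F i * G i) *~ a l =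
    \sum_j F (lift l j) * (G (lift l j) *~ a l - G l *~ a (lift l j)).
Proof.
move=> Fa.
have -> : (\sum_i F i * G i) *~ a l = \sum_i F i * (G i *~ a l - G l *~ a i).
  have E i : F i * (G i *~ a l - G l *~ a i) = (F i * G i) *~ a l - F i *~ a i * G l.
    by rewrite mulrBr !mulrzAr mulrzAl.
  under [RHS]eq_bigr do rewrite E.
  by rewrite sumrB -mulr_suml Fa mul0r subr0 mulrz_suml.
by rewrite (bigD1_ord l) //= subrr mulr0 add0r.
Qed.

Lemma decomp_min m (P : {poly mpol int m}) n c f g : c != 0 -> @decomp m P c n f g ->
  exists n' c' f' g', [/\ (n' <= n)%N, c' != 0, @decomp m P c' n' f' g', indep f' &
     indep (g' : 'I_n' -> mpol int 1)].
Proof.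
elim: n c f g => [|n IH] c f g c0 D.
  by exists 0%N, c, f, g; split=> // a _ [].
have step c' f' g' : c' != 0 -> @decomp m P c' n f' g' -> exists n' c' f' g',
    [/\ (n' <= n.+1)%N, c' != 0, @decomp m P c' n' f' g', indep f' &
     indep (g' : 'I_n' -> mpol int 1)].
  move=> c'0 D'; have [n' [c2 [f2 [g2 [H1 H2 H3 H4 H5]]]]] := IH _ _ _ c'0 D'.
  by exists n', c2, f2, g2; split=> //; apply: leqW.
have mC_mulz (p : {poly int}) z :
    map_poly (mconst int m) (p *~ z) = map_poly (mconst int m) p *~ z by rewrite rmorphMz.
have polyC_mulz (p : mpol int m) z : (p *~ z)%:P = p%:P *~ z :> {poly mpol int m}.
  exact: raddfMz.
have [f_ind|/nindep_exists[a [l [fa al]]]] := pselect (indep f); last first.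
  apply: (step (c * a l) (f \o lift l)
    (fun j => g (lift l j) *~ a l - g l *~ a (lift l j))); first by rewrite mulf_neq0.
  rewrite /decomp mulrzA D (eliminate_term (F := fun i => (f i)%:P)); last first.
    by under eq_bigr do rewrite -polyC_mulz; rewrite -rmorph_sum fa.
  by apply: eq_bigr => j _; rewrite rmorphB /= !mC_mulz.
have [g_ind|/nindep_exists[a [l [ga al]]]] := pselect (indep (g : 'I_n.+1 -> mpol int 1)).
  by exists n.+1, c, f, g.
apply: (step (c * a l) (fun j => f (lift l j) *~ a l - f l *~ a (lift l j)) (g \o lift l)).
  by rewrite mulf_neq0.
rewrite /decomp mulrzA D; under eq_bigr do rewrite mulrC.
rewrite (eliminate_term (F := fun i => map_poly (mconst int m) (g i))); last first.
  under eq_bigr do rewrite -mC_mulz.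
  have {}ga : \sum_i (g i) *~ a i = 0 :> {poly int} := ga.
  by rewrite -rmorph_sum ga rmorph0.
by apply: eq_bigr => j _; rewrite rmorphB /= !polyC_mulz mulrC.
Qed.

Lemma decomp_exists m r (P : {poly mpol int m}) : (size P <= r.+1)%N ->
  exists n c f g, [/\ (n <= r.+1)%N, c != 0, @decomp m P c n f g, indep f &
     indep (g : 'I_n -> mpol int 1)].
Proof.
move=> sP; have [] := @decomp_min m P (size P) 1 (fun i => P`_i) (fun i => 'X^i).
- by [].
- rewrite /decomp -{1}[P]coefK poly_def; apply: eq_bigr => i _.
  by rewrite map_polyXn mul_polyC.
move=> n [c [f [g [H1 H2 H3 H4 H5]]]]; exists n, c, f, g; split=> //.
exact: leq_trans sP.
Qed.

End Decomposition.

(** * Roth's lemma *)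

Section RootOrder.

Lemma staircase_sum (F : realFieldType) (theta : F) (r n : nat) :
  (0 < r)%N -> (n <= r.+1)%N -> 0 <= theta <= 1 ->
  n%:R * (theta ^+ 2 / 4) <= \sum_(j < n) Num.max 0 (theta - j%:R * r%:R^-1).
Proof.
move=> r0 nr /andP[t0 t1].
have R0 : 0 < r%:R :> F by rewrite ltr0n.
pose hh (x : F) := Num.max 0 x ^+ 2.
(* max(0, y) >= r/2 (max(0, y)^2 - max(0, y - 1/r)^2), then telescope *)
have tele : r%:R / 2 * (theta ^+ 2 - hh (theta - n%:R * r%:R^-1)) <=
    \sum_(j < n) Num.max 0 (theta - j%:R * r%:R^-1).
  elim: n {nr} => [|n IH]; first by rewrite big_ord0 mul0r subr0 /hh max_r // subrr mulr0.
  rewrite big_ord_recr /=; apply: le_trans (lerD IH (lexx _)).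
  set x := theta - n%:R * _.
  have -> : theta - n.+1%:R * r%:R^-1 = x - r%:R^-1 by rewrite /x -natr1; ring.
  have ri : 0 < r%:R^-1 :> F by rewrite invr_gt0.
  suff H : hh x - hh (x - r%:R^-1) <= 2 * r%:R^-1 * Num.max 0 x.
    have -> : Num.max 0 x = r%:R / 2 * (2 * r%:R^-1 * Num.max 0 x) by field; lra.
    rewrite -mulrDr ler_wpM2l ?divr_ge0 ?(ltW R0) //.
    by move: (hh x) (hh (x - _)) (_ * Num.max 0 x) H => A B C; lra.
  rewrite /hh; set y := r%:R^-1 in ri *.
  have [x0|x0] := leP x 0; have [xy|xy] := leP (x - y) 0.
  - by lra.
  - by lra.
  - by nra.
  - by nra.
apply: le_trans tele; rewrite /hh.
have n2 : n%:R <= 2 * r%:R :> F by rewrite -natrM ler_nat; lia.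
have E : n%:R * r%:R^-1 * r%:R = n%:R :> F by field; lra.
have n0 : 0 <= n%:R :> F by [].
set u := n%:R * r%:R^-1 in E *.
have u0 : 0 <= u by rewrite mulr_ge0 ?invr_ge0 ?ler0n.
rewrite -E; have [uy|uy] := leP (theta - u) 0.
  rewrite expr0n subr0 /=.
  have u2 : u <= 2 by rewrite -(ler_pM2r R0) E.
  by nra.
have -> : r%:R / 2 * (theta ^+ 2 - (theta - u) ^+ 2) = u * r%:R * (theta - u / 2) by field.
apply: ler_wpM2l; first by rewrite mulr_ge0 // ltW.
by nra.
Qed.

Lemma int_poly_root_factor (S : {poly int}) (p q : int) :
  coprimez p q -> 0 < q -> (map_poly intr S).[p%:~R / q%:~R] = 0 :> rat ->
  exists S', S = (q *: 'X - p%:P) * S'.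
Proof.
move=> cpq q0 root0.
have q0' : q%:~R != 0 :> rat by rewrite intr_eq0 gt_eqF.
have : dvdp ('X - (p%:~R / q%:~R)%:P) (map_poly intr S : {poly rat}) by rewrite dvdp_XsubCl; apply/rootP.
move=> /dvdpP_rat_int [p1 [a a0 Ep1] [r Sr]].
have c1 : a * (p1`_1)%:~R = 1.
  by have := congr1 (fun w : {poly rat} => w`_1) Ep1; rewrite coefB coefX coefC coefZ coef_map /= subr0.
have c0 : a * (p1`_0)%:~R = - (p%:~R / q%:~R).
  by have := congr1 (fun w : {poly rat} => w`_0) Ep1; rewrite coefB coefX coefC coefZ coef_map /= sub0r.
have rel : p1`_0 * q = - (p * p1`_1).
  have E : (p1`_0)%:~R = - (p%:~R / q%:~R) * (p1`_1)%:~R :> rat.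
    by rewrite -c0 mulrAC c1 mul1r.
  by apply: (intr_inj (R := rat)); rewrite rmorphN !rmorphM /= E; field.
have dvd : (q %| p1`_1)%Z.
  have cqp : coprimez q p by rewrite coprimez_sym.
  rewrite -(Gauss_dvdzr p1`_1 cqp); apply/dvdzP; exists (- p1`_0).
  by rewrite mulNr rel opprK.
have [t Et] := dvdzP dvd.
have E0 : p1`_0 = - (p * t).
  by apply: (mulIf (x := q)); rewrite ?gt_eqF // rel Et; ring.
have sp1 : (size p1 <= 2)%N.
  by rewrite -size_rat_int_poly -(size_scale _ a0) -Ep1 size_XsubC.
exists (t%:P * r); rewrite Sr mulrA; congr (_ * _).
apply/polyP => i; rewrite coefMC coefB coefZ coefX coefC.
case: i => [|[|i]] /=.
- by rewrite E0 ?mulr0n ?mulr0 ?sub0r ?mulNr.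
- by rewrite Et ?mulr1n ?mulr1 ?subr0 mulrC.
- by rewrite nth_default ?(leq_trans sp1) // ?mulr0n ?mulr0 ?subr0 ?mul0r.
Qed.

Lemma linear_poly_lead (p q : int) : q != 0 ->
  size (q *: 'X - p%:P) = 2%N /\ lead_coef (q *: 'X - p%:P) = q.
Proof.
move=> q0; have lt : (size (- p%:P) < size (q *: 'X))%N.
  by rewrite size_polyN size_scale // size_polyX ltnS size_polyC_leq1.
by rewrite size_polyDl // lead_coefDl // size_scale // size_polyX lead_coefZ lead_coefX mulr1.
Qed.

Lemma int_poly_root_order (S : {poly int}) (p q : int) :
  coprimez p q -> 0 < q -> S != 0 ->
  exists e S', S = (q *: 'X - p%:P) ^+ e * S' /\
    (map_poly intr S').[p%:~R / q%:~R] != 0 :> rat.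
Proof.
move=> cpq q0; have [n] := ubnP (size S); elim: n S => // n IH S sS S0.
have [root0|] := eqVneq (map_poly intr S).[p%:~R / q%:~R : rat] 0; last first.
  by exists 0%N, S; rewrite mul1r.
have [S' ES] := int_poly_root_factor cpq q0 root0.
have S'0 : S' != 0 by apply: contraNneq S0 => E; rewrite ES E mulr0.
have sl : size (q *: 'X - p%:P) = 2.
  by have [] := @linear_poly_lead p q; rewrite ?gt_eqF.
have l0 : q *: 'X - p%:P != 0 by rewrite -size_poly_gt0 sl.
have [|//|e [S2 [E2 r2]]] := IH S'.
  by move: sS; rewrite ES size_mul // sl.
by exists e.+1, S2; split=> //; rewrite ES E2 exprS mulrA.
Qed.

Lemma int_poly_root_order_lead (S S' : {poly int}) (p q : int) e :
  0 < q -> S != 0 -> S = (q *: 'X - p%:P) ^+ e * S' -> q ^+ e <= `|lead_coef S|.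
Proof.
move=> q0 S0 E.
have S'0 : S' != 0 by apply: contraNneq S0 => E'; rewrite E E' mulr0.
have [//|_ l] := @linear_poly_lead p q; first by rewrite gt_eqF.
rewrite E lead_coefM lead_coef_exp l normrM normrX (gtr0_norm q0) ler_peMr ?exprn_ge0 ?(ltW q0) //.
by rewrite -gtz0_ge1 normr_gt0 lead_coef_eq0.
Qed.

End RootOrder.

Section WronskianSplit.

Lemma index_ge_mconst (F : realFieldType) m w c : index_ge w 0 (mconst F m c).
Proof.
elim: m => [|m IH] /=; first by right.
by move=> [|i]; rewrite coefC /=; [rewrite mul0r subr0 | apply: index_ge0].
Qed.

Lemma index_ge_ext (F : realFieldType) m (w w' : nat -> F) t (P : mpol F m) :
  (forall h, (h < m)%N -> w h = w' h) -> index_ge w t P -> index_ge w' t P.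
Proof.
elim: m t P => [|m IH] t P // ww' H i; rewrite -ww' //.
by apply: IH (H i) => h hm; apply/ww'/ltnW.
Qed.

Lemma mcoef0 (R : idomainType) m nu : @mcoef R m nu 0 = 0.
Proof. by elim: m => [|m IH] //=; rewrite coef0. Qed.

Lemma mcoefM_mconst (R : idomainType) m nu (P : mpol R m) c : mcoef nu (P * mconst R m c) = mcoef nu P * c.
Proof. by elim: m P => [|m IH] P //=; rewrite coefMC IH. Qed.

Lemma mcoef_ext (R : idomainType) m (mu nu : nat -> nat) (P : mpol R m) :
  (forall h, (h < m)%N -> mu h = nu h) -> mcoef mu P = mcoef nu P.
Proof.
elim: m P => [|m IH] P //= E; rewrite E //.
by apply: IH => h hm; apply/E/ltnW.
Qed.

Lemma mcoef_exists (R : idomainType) m (P : mpol R m) : P != 0 -> exists nu, mcoef nu P != 0.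
Proof.
elim: m P => [|m IH] P P0; first by exists id.
have l0 : lead_coef (P : {poly mpol R m}) != 0 by rewrite lead_coef_eq0.
have [nu Hnu] := IH _ l0.
exists (fun h => if h == m then (size P).-1 else nu h).
rewrite /= eqxx -lead_coefE (@mcoef_ext _ _ _ nu) // => h hm.
by rewrite ltn_eqF.
Qed.

Lemma mcoef_l1norm (R : numDomainType) m nu (P : mpol R m) : `|mcoef nu P| <= l1norm P.
Proof.
elim: m P => [|m IH] P //.
by apply: le_trans (IH _) _; apply: (@l1norm_coef R m P).
Qed.

Lemma fact_le_expn n k : (n <= k)%N -> (n`! <= k ^ n)%N.
Proof.
elim: n => [|n IH] // nk; rewrite factS expnS leq_mul //.
exact/IH/ltnW.
Qed.

Lemma expn2_sum_le m H (r : nat -> nat) : (forall h, (h < m)%N -> (2 ^ r h <= H)%N) ->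
  (2 ^ (\sum_(h < m) r h) <= H ^ m)%N.
Proof.
elim: m => [|m IH] Hr; first by rewrite big_ord0.
rewrite big_ord_recr /= expnD expnSr leq_mul ?Hr // IH // => h hm.
exact/Hr/ltnW.
Qed.

Lemma wronskian_split m r (P : {poly mpol int m}) : P != 0 -> (size P <= r.+1)%N ->
  exists n (c : int) (mu : 'I_n -> nat -> nat) (V : mpol int m) (U : {poly int}),
  [/\ (0 < n <= r.+1)%N, c != 0, V != 0 /\ U != 0, forall i, (multideg m (mu i) < n)%N &
  c%:~R * \det (\matrix_(i < n, j < n) (hasse (fun h => if h == m then j : nat else mu i h)
       (P : mpol int m.+1) : {poly mpol int m}))
   = V%:P * map_poly (mconst int m) U].
Proof.
move=> P0 sP; have [n [c [f [g [nr c0 D f_ind g_ind]]]]] := decomp_exists sP.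
have [mu [mun V0]] := wronskian_exists f_ind.
have U0 := wronskian1 g_ind.
exists n, (c ^+ n), mu, (\det (\matrix_(i, l) hasse (mu i) (f l))),
  (\det (\matrix_(l < n, j < n) (g l)^`N(j))); split; last first.
- set A := \matrix_(i, l) hasse (mu i) (f l).
  have -> : (\det A)%:P = \det (map_mx polyC A) by rewrite det_map_mx.
  rewrite rmorphXn /= -detZ -det_map_mx -det_mulmx.
  congr (\det _); apply/matrixP => i j; rewrite !mxE.
  rewrite mulrC mulrzr -(@hasseMz int m.+1) D (@hasse_sum int m.+1); apply: eq_bigr => l _.
  rewrite !mxE /= eqxx; apply/polyP => k.
  rewrite coefCM !coef_map coef_map_id0 ?hasse0 // !coef_nderivn coefCM coef_map.
  rewrite hasseMn [f l * _]mulrC hasseZ raddfMn mulrnAr [X in X *+ _ = _]mulrC.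
  by rewrite (@hasse_ext _ _ _ (mu i)) // => h hm; rewrite ltn_eqF.
- exact: mun.
- by split; [exact: V0|exact: U0].
- by rewrite expf_neq0.
rewrite nr andbT lt0n; apply: contraNneq P0 => n0.
have : P *~ c = 0 by rewrite D; move: f g {mun V0 U0 D f_ind g_ind}; rewrite n0 => f g; rewrite big_ord0.
by move=> /(@mpol_mulrz_eq0 m.+1)[E|->//]; rewrite E eqxx in c0.
Qed.

End WronskianSplit.

Section WronskianIndex.
Variable F : archiRealFieldType.
Notation ti := (@taylor int F intr).

Lemma wronskian_index m (xi : nat -> F) (r : nat -> nat) (eps : F) s n
    (P : mpol int m.+1) (mu : 'I_n -> nat -> nat) :
  0 < eps <= 1 -> (forall h, (h < m.+1)%N -> (0 < r h)%N) ->
  (n <= (r m).+1)%N -> (forall i, (multideg m (mu i) < n)%N) ->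
  (0 < s)%N -> s%:R^-1 <= eps / 2 -> (forall h, (h < m)%N -> (s * r m <= r h)%N) ->
  index_ge (fun h => (r h)%:R^-1) eps (ti xi m.+1 P) ->
  index_ge (fun h => (r h)%:R^-1) (n%:R * (eps ^+ 2 / 16))
    (ti xi m.+1 (\det (\matrix_(i < n, j < n)
       (hasse (fun h => if h == m then j : nat else mu i h) P)))).
Proof.
move=> /andP[e0 e1] r0 nr mun s0 se rs HP.
set w := fun h => _ in HP *.
have w0 h : (h < m.+1)%N -> 0 <= w h by rewrite /w invr_ge0 ler0n.
rewrite -det_map_mx.
apply: (@index_ge_mono _ _ _ (\sum_(j < n) Num.max 0 (eps / 2 - j%:R * w m))).
  have -> : eps ^+ 2 / 16 = (eps / 2) ^+ 2 / 4 by field.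
  by apply: staircase_sum nr _; rewrite ?r0 //; lra.
apply: index_ge_det => i j; rewrite !mxE.
have [_|_] := leP (eps / 2 - j%:R * w m) 0; first by apply: index_ge_le0.
rewrite taylor_hasse; apply: index_ge_mono (index_ge_hasse _ HP).
rewrite big_ord_recr /= eqxx.
suff : \sum_(h < m) ((if h == m :> nat then j : nat else mu i h)%:R * w h) <= eps / 2 by lra.
apply: le_trans se.
have rm : 0 < (r m)%:R :> F by rewrite ltr0n r0.
have S0 : 0 < s%:R :> F by rewrite ltr0n.
apply: (@le_trans _ _ (\sum_(h < m) (mu i h)%:R * (s%:R * (r m)%:R)^-1)).
  apply: ler_sum => h _; rewrite ltn_eqF //; apply: ler_wpM2l => //.
  rewrite lef_pV2 ?posrE ?mulr_gt0 ?ltr0n ?r0 //; last by rewrite (ltn_trans (ltn_ord h)).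
  by rewrite -natrM ler_nat rs.
rewrite -mulr_suml -natr_sum ler_pdivrMr ?mulr_gt0 // mulKf ?gt_eqF // ler_nat.
by rewrite -ltnS (leq_trans (mun i) nr).
Qed.

Lemma shifted_root_coef (S : {poly int}) (p q : int) e S' :
  0 < q -> S = (q *: 'X - p%:P) ^+ e * S' ->
  (map_poly intr S').[p%:~R / q%:~R : rat] != 0 ->
  (map_poly intr S \Po ('X + (p%:~R / q%:~R)%:P) : {poly F})`_e != 0.
Proof.
move=> q0 -> S'0.
have q0' : q%:~R != 0 :> F by rewrite intr_eq0 gt_eqF.
set x : F := p%:~R / q%:~R.
have xE : x = ratr (p%:~R / q%:~R) by rewrite fmorph_div /= !ratr_int.
have qx : q%:~R * x = p%:~R by rewrite /x mulrCA divff ?mulr1.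
clearbody x; rewrite !rmorphM !rmorphXn /= !rmorphB /= map_polyZ /= map_polyX map_polyC /=.
rewrite comp_polyZ comp_polyX comp_polyC.
have -> : q%:~R *: ('X + x%:P) - (p%:~R)%:P = q%:~R *: 'X.
  by rewrite scalerDr -addrA scale_polyC qx subrr addr0.
rewrite exprZn -scalerAl coefZ coefXnM ltnn subnn mulf_neq0 ?expf_neq0 //.
rewrite -horner_coef0 horner_comp !hornerE.
have -> : map_poly intr S' = map_poly (ratr : rat -> F) (map_poly intr S').
  by rewrite -map_poly_comp; apply: eq_map_poly => c /=; rewrite ratr_int.
by rewrite xE horner_map fmorph_eq0.
Qed.

End WronskianIndex.

Section RothLemma.
Variable F : archiRealFieldType.
Notation ti := (@taylor int F intr).
Notation winv r := (fun h : nat => (r h)%:R^-1).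

(* A slice of c W = V U in the last variable is proportional to U, one in the
   other variables to V. So the order of U at p/q is controlled by the size of
   the integer W, without any height bound on U or V themselves. *)
Lemma wronskian_slice m (p q : nat -> int) (w : nat -> F) t c
    (W : {poly mpol int m}) V U : c != 0 -> V != 0 -> U != 0 ->
  coprimez (p m) (q m) -> 0 < q m ->
  c%:~R * W = V%:P * map_poly (mconst int m) U ->
  index_ge w t (ti (fun h => (p h)%:~R / (q h)%:~R) m.+1 W) ->
  exists e i, [/\ q m ^+ e <= l1norm (W : mpol int m.+1), W`_i != 0 &
    index_ge w (t - e%:R * w m) (ti (fun h => (p h)%:~R / (q h)%:~R) m W`_i)].
Proof.
move=> c0 V0 U0 cpq q0 E HW; set xi := fun h => _ in HW *.
have xim : xi m = (p m)%:~R / (q m)%:~R by [].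
clearbody xi.
have cC : c%:~R = (mconst int m c)%:P :> {poly mpol int m}.
  by rewrite -[c in RHS]intz rmorph_int rmorph_int.
rewrite cC in E.
have Ei i : mconst int m c * W`_i = V * mconst int m U`_i.
  by have := congr1 (fun w : {poly mpol int m} => w`_i) E; rewrite /= !coefCM coef_map.
have [nu v0] := mcoef_exists V0.
pose S := map_poly (mcoef nu) W.
have SE i : c * S`_i = mcoef nu V * U`_i.
  by rewrite coef_map_id0 ?mcoef0 // -mcoefM_mconst -Ei [mconst _ _ _ * _]mulrC mcoefM_mconst mulrC.
have S0 : S != 0.
  apply: contraNneq (mulf_neq0 v0 (_ : lead_coef U != 0)) => [S0|]; last by rewrite lead_coef_eq0.
  by rewrite lead_coefE -SE S0 coef0 mulr0.
have [e [S' [ES S'0]]] := int_poly_root_order cpq q0 S0.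
have [i Wi0] : exists i, W`_i != 0.
  exists (size W).-1; rewrite -lead_coefE lead_coef_eq0.
  by apply: contraNneq S0 => W0; rewrite /S W0 map_poly0.
exists e, i; split=> //.
  apply: le_trans (int_poly_root_order_lead q0 S0 ES) _.
  rewrite lead_coefE coef_map_id0 ?mcoef0 //.
  by apply: le_trans (mcoef_l1norm _ _) (l1norm_coef _ _).
pose US := (map_poly intr U : {poly F}) \Po ('X + (xi m)%:P).
have ue0 : US`_e != 0.
  have := shifted_root_coef F q0 ES S'0; rewrite -xim => Se.
  have cSU : c%:P * S = (mcoef nu V)%:P * U by apply/polyP => k; rewrite !coefCM SE.
  have := congr1 (fun p : {poly int} => ((map_poly intr p : {poly F}) \Po ('X + (xi m)%:P))`_e) cSU.
  rewrite /= !rmorphM /= !map_polyC /= !comp_polyC !coefCM -/US => cS.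
  have : c%:~R * (map_poly intr S \Po ('X + (xi m)%:P))`_e != 0 :> F by rewrite mulf_neq0 ?intr_eq0.
  by rewrite cS mulf_eq0 => /norP[].
have mCF (x : int) k (P : mpol int k) : ti xi k (mconst int k x * P) = mconst F k x%:~R * ti xi k P.
  by rewrite rmorphM taylor_mconst.
have tE : mconst F m c%:~R * (ti xi m.+1 W : {poly mpol F m})`_e = ti xi m V * mconst F m US`_e.
  have := congr1 (fun P : {poly mpol int m} => (ti xi m.+1 P : {poly mpol F m})`_e) E.
  rewrite /= !rmorphM /= !map_polyC /= !comp_polyC !coefCM taylor_mconst => ->; congr (_ * _).
  rewrite /US -(coef_map (mconst F m)) map_comp_poly rmorphD /= map_polyX map_polyC /=.
  congr ((_ \Po _)`_ _); apply/polyP => k.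
  by rewrite coef_map_taylor !coef_map /= taylor_mconst.
have HV : index_ge w (t - e%:R * w m) (ti xi m V).
  apply: (index_ge_mconstM ue0); rewrite [mconst F m _ * _]mulrC -tE -[X in index_ge _ X]add0r.
  by apply: index_geM (index_ge_mconst _ _ _) _; apply: HW.
apply: (@index_ge_mconstM _ _ _ _ c%:~R); first by rewrite intr_eq0.
rewrite -mCF Ei rmorphM taylor_mconst -[X in index_ge _ X]addr0.
by apply: index_geM HV (index_ge_mconst _ _ _).
Qed.

(* H bounds both the coefficients and 2^deg; with q_h^r_h >= H^s, the index
   condition log H << r_h log q_h is expressed without logarithms. *)
Lemma roth_lemma m (eps : F) : 0 < eps <= 1 -> exists s : nat, (0 < s)%N /\
  forall (r : nat -> nat) (p q : nat -> int) (H : nat) (P : mpol int m),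
  P != 0 -> deg_le r P -> l1norm P <= H%:R ->
  (forall h, (h < m)%N -> [/\ (0 < r h)%N, (2 ^ r h <= H)%N, coprimez (p h) (q h), 0 < q h
     & (H ^ s)%:R <= q h ^+ r h]) ->
  (forall h h', (h < h' < m)%N -> (s * r h' <= r h)%N) ->
  ~ index_ge (winv r) eps (ti (fun h => (p h)%:~R / (q h)%:~R) m P).
Proof.
elim: m eps => [|m IH] eps /andP[e0 e1].
  exists 1%N; split=> // r p q H P P0 _ _ _ _ /=.
  by move=> [/eqP|]; [rewrite intr_eq0 => /eqP PP; case/eqP: P0 | lra].
have eps2 : 0 < eps ^+ 2 by rewrite exprn_gt0.
have [|s1 [s10 {}IH]] := IH (eps ^+ 2 / 32); first by apply/andP; split; nra.
have [t0 Ht0] : exists t0 : nat, 32 / eps ^+ 2 <= t0%:R.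
  by exists (Num.Def.archi_bound (32 / eps ^+ 2)); apply/ltW/archi_boundP/divr_ge0 => //; apply: ltW.
have [t1 Ht1] : exists t1 : nat, 2 / eps <= t1%:R.
  by exists (Num.Def.archi_bound (2 / eps)); apply/ltW/archi_boundP/divr_ge0 => //; apply: ltW.
have [s [s0 s1_le t0_le t1_le]] : exists s : nat,
    [/\ (0 < s)%N, ((m + 3) * s1 <= s)%N, ((m + 3) * t0 <= s)%N & (t1 <= s)%N].
  by exists ((m + 3) * s1 + (m + 3) * t0 + t1 + 1)%N; split; lia.
exists s; split=> // r p q H P P0 dP nP hyp sr HP.
change {poly mpol int m} in P.
have [sP cP] := dP.
have [n [c [mu [V [U [/andP[n0 nr] c0 [V0 U0] mun EW]]]]]] := wronskian_split P0 sP.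
set W := \det _ in EW.
have rs h : (h < m)%N -> (s * r m <= r h)%N by move=> hm; apply: sr; rewrite hm ltnS leqnn.
have se : s%:R^-1 <= eps / 2.
  rewrite -[eps / 2]invrK lef_pV2 ?posrE ?invr_gt0 ?divr_gt0 ?ltr0n //.
  by rewrite invf_div (le_trans Ht1) // ler_nat.
have r0 h : (h < m.+1)%N -> (0 < r h)%N by move=> /hyp[].
have e01 : 0 < eps <= 1 by rewrite e0.
have HW := wronskian_index e01 r0 nr mun s0 se rs HP.
have [_ _ cpq q0 Hq] := hyp m (ltnSn m).
have [e [i [qe Wi0 HWi]]] := wronskian_slice c0 V0 U0 cpq q0 EW HW.
have H1 : (1 <= H)%N by have [_ H1 _ _ _] := hyp m (ltnSn m); apply: leq_trans H1; rewrite expn_gt0.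
have nH : (n <= H)%N.
  apply: leq_trans nr _; have [_ H2 _ _ _] := hyp m (ltnSn m); apply: leq_trans H2.
  exact: ltn_expl.
have nW : l1norm (W : mpol int m.+1) <= (H ^ ((m + 3) * n))%:R.
  apply: le_trans (l1norm_det (b := (H ^ (m + 2))%:R) _) _.
    move=> a b; rewrite mxE; apply: le_trans (l1norm_hasse _ dP) _.
    rewrite -natrX -(addSnnS m 1) expnD natrM.
    by apply: ler_pM; rewrite ?l1norm_ge0 // ler_nat expn2_sum_le // => h /hyp[].
  rewrite -natrX -natrM ler_nat -expnM.
  rewrite (addnS m 2) mulSn.
  by rewrite expnD leq_mul2r fact_le_expn ?orbT.
have et : (e * t0 <= n * r m)%N.
  have q1 : (1 < q m)%R.
    rewrite lt_neqAle -gtz0_ge1 q0 andbT eq_sym; apply/eqP => q1.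
    move: Hq; rewrite q1 expr1n -[1]/(1%:R) ler_nat leqNgt => /negP; apply.
    apply: (@leq_trans H); last by rewrite -{1}[H]expn1 leq_pexp2l.
    by have [r0' H2 _ _ _] := hyp m (ltnSn m); apply: leq_trans H2; rewrite -(expn0 2) ltn_exp2l.
  rewrite -(ler_eXn2l (x := q m)) //.
  apply: (@le_trans _ _ ((H ^ ((m + 3) * n * t0))%:R)).
    rewrite exprM expnM natrX lerXn2r ?nnegrE ?exprn_ge0 ?ler0n //; last exact: le_trans nW.
    exact: ltW.
  apply: (@le_trans _ _ ((H ^ (s * n))%:R)).
    by rewrite ler_nat leq_pexp2l // mulnAC leq_mul.
  by rewrite [(n * r m)%N]mulnC exprM expnM natrX lerXn2r ?nnegrE ?exprn_ge0 ?ler0n // ltW.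
apply: (IH (fun h => n * r h)%N p q (H ^ ((m + 3) * n))%N _ Wi0).
- have dW : @deg_le int m.+1 (fun h => n * r h)%N W.
    by apply: (@deg_le_det int m.+1) => a b; rewrite mxE; apply: (@deg_le_hasse int m.+1).
  by case: dW => _; apply.
- exact: le_trans (l1norm_coef _ _) nW.
- move=> h hm; have [rh0 rH cpqh qh0 Hh] := hyp h (ltnW hm).
  split=> //; first by rewrite muln_gt0 n0.
    apply: (@leq_trans (H ^ n)); first by rewrite mulnC expnM leq_exp2r.
    by rewrite leq_pexp2l // leq_pmull // addn3.
  apply: (@le_trans _ _ ((H ^ (s * n))%:R)).
    by rewrite -expnM ler_nat leq_pexp2l // mulnAC leq_mul.
  by rewrite [(n * _)%N]mulnC exprM expnM natrX lerXn2r ?nnegrE ?exprn_ge0 ?ler0n // ltW.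
- move=> h h' /andP[hh hm].
  have := sr h h'; rewrite hh ltnS (ltnW hm) => /(_ erefl) /(leq_mul (leqnn n)).
  apply: leq_trans; rewrite mulnCA leq_mul // leq_mul //.
  by apply: leq_trans s1_le; rewrite leq_pmull // addn3.
have N0 : 0 < n%:R :> F by rewrite ltr0n.
apply: (@index_ge_ext _ _ (fun h => n%:R^-1 * (r h)%:R^-1)).
  by move=> h hm; rewrite natrM invfM.
apply: (index_ge_scale (w := winv r)) => //; apply: index_ge_mono HWi.
have rm0 : 0 < (r m)%:R :> F by rewrite ltr0n r0.
suff : e%:R * (r m)%:R^-1 <= n%:R * (eps ^+ 2 / 32) by lra.
rewrite ler_pdivrMr //.
have T0 : 0 < t0%:R :> F by apply: lt_le_trans Ht0; rewrite divr_gt0.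
rewrite -(ler_pM2r T0) -natrM.
apply: (@le_trans _ _ ((n * r m)%:R)); first by rewrite ler_nat.
rewrite natrM -mulrA mulrAC -!mulrA ler_wpM2l ?ler0n //.
move: Ht0; rewrite ler_pdivrMr // => Ht0.
by nra.
Qed.

End RothLemma.

(** * The auxiliary polynomial *)

Section Siegel.

Lemma siegel (I J : finType) (a : J -> I -> int) (A : nat) :
  (0 < A)%N -> (forall j i, (`|a j i| <= A)%N) -> (0 < #|I|)%N -> (2 * #|J| <= #|I|)%N ->
  exists x : I -> int, [/\ exists i, x i != 0,
    forall i, (`|x i| <= 2 * #|I| * A)%N & forall j, \sum_i a j i * x i = 0].
Proof.
move=> A0 aA I0 JI; set X := (2 * #|I| * A)%N.
have X0 : (0 < X)%N by rewrite /X !muln_gt0 I0.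
pose val_at (x : {ffun I -> 'I_X.+1}) j : int := \sum_i a j i * (x i)%:Z.
pose B := (#|I| * A * X)%N.
have valB x j : `|val_at x j| <= B%:Z.
  apply: le_trans (ler_norm_sum _ _ _) _.
  apply: (@le_trans _ _ (\sum_(i : I) (A * X)%:Z)).
    apply: ler_sum => i _; rewrite normrM PoszM ler_pM //; first by have := aA j i; lia.
    by have := ltn_ord (x i); lia.
  by rewrite sumr_const -mulr_natl natz -PoszM /B mulnA.
pose f x : {ffun J -> 'I_(2 * B).+1} := [ffun j => inord (absz (val_at x j + B%:Z))].
have ninj : ~ injective f.
  move=> /leq_card; rewrite !card_ffun !card_ord leqNgt => /negP; apply.
  have -> : (2 * B = X * X)%N by rewrite /B /X; ring.
  have [J0|J0] := posnP #|J|; first by rewrite J0 expn0 -{1}(expn0 X.+1) ltn_exp2l.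
  apply: leq_trans (_ : (X.+1 ^ 2) ^ #|J| <= _)%N; last by rewrite -expnM leq_pexp2l.
  by rewrite ltn_exp2r //; nia.
have [x [y [fxy xy]]] : exists x y, f x = f y /\ x <> y.
  apply: contrapT => no; apply: ninj => x y fxy; apply: contrapT => xy.
  by apply: no; exists x, y.
exists (fun i => (x i)%:Z - (y i)%:Z); split=> [|i|j].
- apply: contrapT => no; apply: xy; apply/ffunP => i; apply/val_inj => /=.
  apply/eqP; apply: contraT => ne; case: no; exists i; rewrite subr_eq0.
  by apply: contra ne => /eqP[->].
- by have := ltn_ord (x i); have := ltn_ord (y i); rewrite -/X; lia.
have : val_at x j = val_at y j.
  have := congr1 (fun g : {ffun J -> 'I_(2 * B).+1} => g j : nat) fxy.
  have := valB x j; have := valB y j; rewrite !ffunE.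
  by move: (val_at x j) (val_at y j) => u v Hv Hu; rewrite !inordK; lia.
rewrite /val_at => E; under eq_bigr do rewrite mulrBr.
by rewrite sumrB E subrr.
Qed.

End Siegel.

Section Box.

Fixpoint box (m : nat) (r : nat -> nat) : seq (seq nat) :=
  if m is m'.+1 then [seq rcons s i | s <- box m' r, i <- iota 0 (r m').+1] else [:: [::]].

Lemma boxP m r s : s \in box m r -> size s = m /\ forall h, (h < m)%N -> (nth 0 s h <= r h)%N.
Proof.
elim: m s => [|m IH] s; first by rewrite inE => /eqP ->.
move=> /allpairsPdep[s' [i [/IH[ss' Hs'] Hi ->]]]; rewrite size_rcons ss'; split=> // h hm.
rewrite nth_rcons ss'; case: ltngtP => // [hm'|->]; first exact: Hs'.
by move: Hi; rewrite mem_iota ltnS.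
Qed.

Lemma mem_box m r (nu : nat -> nat) : (forall h, (h < m)%N -> (nu h <= r h)%N) -> mkseq nu m \in box m r.
Proof.
elim: m => [|m IH] H; first by rewrite inE.
rewrite mkseqS; apply/allpairsPdep; exists (mkseq nu m), (nu m); split=> //.
  by apply: IH => h hm; apply/H/ltnW.
by rewrite mem_iota ltnS H.
Qed.

Lemma box_uniq m r : uniq (box m r).
Proof.
elim: m => [|m IH] //; apply: allpairs_uniq_dep => // [s _|]; first exact: iota_uniq.
by move=> [s i] [s' i'] _ _ /= /rcons_inj[-> ->].
Qed.

Lemma size_box m r : size (box m r) = (\prod_(h < m) (r h).+1)%N.
Proof.
elim: m => [|m IH]; first by rewrite big_ord0.
by rewrite [LHS]size_allpairs size_iota IH big_ord_recr.
Qed.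

Lemma big_box (V : zmodType) m r (G : seq nat -> V) :
  \sum_(s <- box m.+1 r) G s = \sum_(s <- box m r) \sum_(i < (r m).+1) G (rcons s i).
Proof.
have -> : box m.+1 r = [seq rcons s i | s <- box m r, i <- iota 0 (r m).+1] by [].
rewrite big_allpairs_dep; apply: eq_bigr => s _.
by rewrite -(big_mkord xpredT (fun i => G (rcons s i))) /index_iota subn0.
Qed.

Variable F : realFieldType.

Definition deviation (r : nat -> nat) m (s : seq nat) : F :=
  \sum_(h < m) ((nth 0%N s h)%:R / (r h)%:R - 1 / 2).

Lemma deviation_rcons r m s i : size s = m ->
  deviation r m.+1 (rcons s i) = deviation r m s + (i%:R / (r m)%:R - 1 / 2).
Proof.
move=> ss; rewrite /deviation big_ord_recr /= nth_rcons ss ltnn eqxx; congr (_ + _).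
by apply: eq_bigr => h _; rewrite nth_rcons ss ltn_ord.
Qed.

Lemma sum_centered (r : nat) : (0 < r)%N -> \sum_(i < r.+1) (i%:R / r%:R - 1 / 2 : F) = 0.
Proof.
move=> r0; have R0 : r%:R != 0 :> F by rewrite pnatr_eq0 -lt0n.
rewrite sumrB -mulr_suml sumr_const card_ord -natr_sum.
have -> : (\sum_(i < r.+1) i)%N = 'C(r.+1, 2) by rewrite -bin2_sum big_mkord.
have E : 'C(r.+1, 2)%:R * 2 = r.+1%:R * r%:R :> F.
  by rewrite -!natrM; congr (_%:R); have := mul_bin_diag r.+1 1; rewrite bin1; lia.
have -> : 'C(r.+1, 2)%:R = r.+1%:R * r%:R / 2 :> F by rewrite -E mulfK // pnatr_eq0.
rewrite -mulr_natl; field; by [].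
Qed.

Lemma big_const_seq_natr (T : Type) (s : seq T) (c : F) : \sum_(i <- s) c = (size s)%:R * c.
Proof. by rewrite big_const_seq count_predT iter_addr_0 mulr_natl. Qed.

(* The variance of s_h/r_h, for s uniform in the box, is at most 1/4. *)
Lemma sum_deviation_sq m r : (forall h, (h < m)%N -> (0 < r h)%N) ->
  \sum_(s <- box m r) deviation r m s ^+ 2 <= (size (box m r))%:R * (m%:R / 4).
Proof.
elim: m => [|m IH] r0; first by rewrite big_seq1 /deviation big_ord0 expr0n mul0r mulr0.
have r0' h : (h < m)%N -> (0 < r h)%N by move=> hm; apply/r0/ltnW.
have R0 : 0 < (r m)%:R :> F by rewrite ltr0n r0.
pose c : F := \sum_(i < (r m).+1) (i%:R / (r m)%:R - 1 / 2) ^+ 2.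
have cle : c <= (r m).+1%:R / 4.
  apply: (@le_trans _ _ (\sum_(i < (r m).+1) (1 / 4))); last first.
    by rewrite sumr_const card_ord -[X in X <= _]mulr_natl mul1r.
  apply: ler_sum => i _.
  have : 0 <= (i%:R : F) / (r m)%:R <= 1.
    by rewrite divr_ge0 ?ler0n //= ler_pdivrMr // mul1r ler_nat -ltnS.
  by move: (_ / _) => x /andP[x0 x1]; nra.
have -> : \sum_(s <- box m.+1 r) deviation r m.+1 s ^+ 2 =
    (r m).+1%:R * \sum_(s <- box m r) deviation r m s ^+ 2 + (size (box m r))%:R * c.
  rewrite big_box mulr_sumr -(big_const_seq_natr _ c) -big_split big_seq [RHS]big_seq.
  apply: eq_bigr => s /boxP[ss _]; under eq_bigr do rewrite deviation_rcons // sqrrD.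
  rewrite !big_split /= sumr_const card_ord.
  rewrite -mulr_sumr sum_centered ?r0 //.
  by rewrite mulr0 !addr0 -[X in X + _ = _]mulr_natl.
have := IH r0'; rewrite (size_box m.+1) big_ord_recr -size_box /= natrM.
have s0 : 0 <= (size (box m r))%:R :> F by [].
have R1 : 0 <= (r m).+1%:R :> F by [].
rewrite -(natr1 m) => /(ler_wpM2l R1) H1; have H2 := ler_wpM2l s0 cle.
by move: H1 H2; move: (r m).+1%:R (\sum_(s <- _) _) (size _)%:R => A S N; lra.
Qed.

Lemma chebyshev_box m r (eps : F) : (forall h, (h < m)%N -> (0 < r h)%N) -> 0 < eps ->
  (count (fun s => \sum_(h < m) (nth 0%N s h)%:R / (r h)%:R <= m%:R * (1 / 2 - eps)) (box m r))%:R
    * (4 * eps ^+ 2 * m%:R ^+ 2) <= (size (box m r))%:R * m%:R.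
Proof.
move=> r0 e0; set p : pred (seq nat) := fun s => _.
apply: le_trans (_ : 4 * \sum_(s <- box m r) deviation r m s ^+ 2 <= _).
  rewrite -size_filter -sum1_size natr_sum mulr_suml mulr_sumr big_filter.
  rewrite [X in _ <= X](bigID p) /= -[X in X <= _]addr0 lerD //; last first.
    by apply: sumr_ge0 => s _; rewrite mulr_ge0 ?sqr_ge0.
  apply: ler_sum => s ps; rewrite mul1r -mulrA ler_wpM2l //.
  have : deviation r m s <= - (m%:R * eps).
    rewrite /deviation sumrB sumr_const card_ord -mulr_natl.
    by move: ps; rewrite /p; lra.
  have : 0 <= m%:R * eps by rewrite mulr_ge0 // ltW.
  move: (deviation _ _ _) => D M0 DM; rewrite mulrC -exprMn -[D ^+ 2]sqrrN.
  by rewrite lerXn2r ?nnegrE; lra.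
apply: le_trans (_ : 4 * ((size (box m r))%:R * (m%:R / 4)) <= _); last lra.
by rewrite ler_wpM2l ?sum_deviation_sq.
Qed.

End Box.

Section Auxiliary.
Variable F : archiRealFieldType.
Notation winv r := (fun h : nat => (r h)%:R^-1 : F).

Lemma algebraic_powers (alpha : F) : algebraicOver (ratr : rat -> F) alpha ->
  exists (d c : nat) (D : int) (rho : nat -> nat -> int),
  [/\ (0 < c)%N, D != 0, forall k l, (l < d)%N -> (absz (rho k l) <= c ^ k)%N &
    forall k, D%:~R ^+ k * alpha ^+ k = \sum_(l < d) (rho k l)%:~R * alpha ^+ l].
Proof.
move=> [p p0 rp]; have [z [a a0 Ep]] := rat_poly_scale p.
have z0 : z != 0 by apply: contraNneq p0 => E; rewrite Ep E rmorph0 scaler0.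
have zr : (map_poly intr z : {poly F}).[alpha] = 0.
  have : root (map_poly (ratr : rat -> F) (map_poly intr z)) alpha.
    by move: rp; rewrite Ep map_polyZ rootZ // fmorph_eq0 invr_eq0 intr_eq0.
  rewrite -map_poly_comp => /rootP; rewrite (@eq_map_poly _ _ _ intr) // => x /=.
  by rewrite ratr_int.
have zmr : size (map_poly intr z : {poly F}) = size z.
  by rewrite size_map_poly_id0 // intr_eq0 lead_coef_eq0.
case Ed: (size z) zmr => [|[|e]] zmr.
- by move/eqP: Ed z0; rewrite size_poly_eq0 => ->.
- move: zr; rewrite horner_coef zmr big_ord1 expr0 mulr1 coef_map /= => /eqP.
  by rewrite intr_eq0 -[0%N]/(1.-1) -Ed -lead_coefE lead_coef_eq0 (negbTE z0).
pose D := z`_e.+1; pose c := (\sum_(i < e.+2) absz (z`_i)%R)%N.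
have D0 : D != 0 by rewrite /D -[e.+1]/(e.+2.-1) -Ed -lead_coefE lead_coef_eq0.
pose fix rho (k l : nat) {struct k} : int :=
  if k is k'.+1 then (if l is l'.+1 then D * rho k' l' else 0) - z`_l * rho k' e
  else (l == 0%N)%:R.
have cz i : (i < e.+1)%N -> (absz D + absz (z`_i)%R <= c)%N.
  by move=> ie; rewrite /c big_ord_recr /= addnC leq_add2r (bigD1 (Ordinal ie)) //= leq_addr.
have c0 : (0 < c)%N by have := cz 0%N isT; have : (0 < absz D)%N; [rewrite absz_gt0 | lia].
exists e.+1, c, D, rho; split=> // [k|k].
  elim: k => [|k IH] l le /=; first by case: (l == 0%N).
  have := IH e (ltnSn e); have := cz l le; rewrite expnS.
  set t := if l is _.+1 then _ else _.
  have : (absz t <= absz D * c ^ k)%N.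
    rewrite /t; case: l le {t} => [|l] le //; rewrite abszM leq_mul2l IH ?orbT //.
    exact: ltnW.
  move: t => t Ht Hc He.
  apply: (@leq_trans (absz t + absz (z`_l)%R * absz (rho k e))%N).
    by rewrite -abszM; move: (_ * rho k e) => u; lia.
  apply: (@leq_trans (absz D * c ^ k + absz (z`_l)%R * c ^ k)%N).
    by rewrite leq_add // leq_mul2l He orbT.
  by rewrite -mulnDl leq_mul2r Hc orbT.
have Da : D%:~R * alpha ^+ e.+1 = - \sum_(l < e.+1) (z`_l)%:~R * alpha ^+ l.
  move: zr; rewrite horner_coef zmr big_ord_recr /= coef_map /= -/D.
  move/eqP; rewrite addrC addr_eq0 => /eqP ->; congr (- _).
  by apply: eq_bigr => l _; rewrite coef_map.
elim: k => [|k IH].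
  rewrite !expr0 mul1r big_ord_recl /= expr0 mulr1 big1 ?addr0 // => i _.
  by rewrite mul0r.
rewrite exprS [alpha ^+ _]exprS mulrACA IH mulr_sumr big_ord_recr /=.
under [in RHS]eq_bigr do rewrite rmorphB /= mulrBl.
rewrite sumrB [X in _ = X - _]big_ord_recl /= mul0r add0r; congr (_ + _).
  by apply: eq_bigr => l _; rewrite rmorphM /= exprS; ring.
have -> : D%:~R * alpha * ((rho k e)%:~R * alpha ^+ e) = (rho k e)%:~R * (D%:~R * alpha ^+ e.+1).
  by rewrite exprS; ring.
rewrite Da mulrN mulr_sumr; congr (- _).
by apply: eq_bigr => l _; rewrite rmorphM /=; ring.
Qed.

Fixpoint monom (m : nat) (s : nat -> nat) : mpol int m :=
  if m is m'.+1 return mpol int m then ((monom m' s)%:P * 'X^(s m') : {poly mpol int m'}) else 1.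

Lemma deg_le_monom m r s : (forall h, (h < m)%N -> (s h <= r h)%N) -> deg_le r (monom m s).
Proof.
elim: m => [|m IH] H //=; split=> [|i].
  apply/leq_sizeP => j Hj; rewrite coefMXn coefC.
  by have := H m (ltnSn m); case: ltnP => // _ sr; case: eqP => //; lia.
rewrite coefMXn coefC; case: ifP => _; first exact: deg_le0.
by case: ifP => _; [apply: IH => h hm; apply/H/ltnW | apply: deg_le0].
Qed.

Lemma l1norm_monom m s : l1norm (monom m s) = 1.
Proof. by elim: m => [|m IH]; rewrite ?l1norm1 // [LHS]l1normXn [LHS]l1normC. Qed.

Lemma mcoef_monom m s : mcoef s (monom m s) = 1.
Proof. by elim: m => [|m IH] //=; rewrite coefMXn ltnn subnn coefC. Qed.

Lemma mcoef_monom0 m s nu h : (h < m)%N -> nu h != s h -> mcoef nu (monom m s) = 0.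
Proof.
elim: m => [|m IH] // hm ne; rewrite /= coefMXn coefC; case: ltnP => ns; first exact: mcoef0.
case: eqP => e; last exact: mcoef0.
apply: IH; last exact: ne.
rewrite ltn_neqAle -ltnS hm andbT; apply: contraNneq ne => ->.
by apply/eqP; lia.
Qed.

Lemma mcoefD (R : idomainType) m nu : {morph @mcoef R m nu : P Q / P + Q}.
Proof. by elim: m => [|m IH] P Q //=; rewrite coefD IH. Qed.

Lemma mcoef_sum (R : idomainType) m nu I (s : seq I) (f : I -> mpol R m) :
  mcoef nu (\sum_(i <- s) f i) = \sum_(i <- s) mcoef nu (f i).
Proof. exact: (big_morph _ (mcoefD nu) (mcoef0 R m nu)). Qed.

Lemma mcoefMz (R : idomainType) m nu (P : mpol R m) z : mcoef nu (P *~ z) = mcoef nu P *~ z.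
Proof.
have N Q : mcoef nu (- Q : mpol R m) = - mcoef nu Q.
  by apply: (addrI (mcoef nu Q)); rewrite -mcoefD !subrr mcoef0.
have M n : mcoef nu (P *+ n) = mcoef nu P *+ n.
  by elim: n => [|n IH]; rewrite ?mulr0n ?mcoef0 // !mulrS mcoefD IH.
by case: z => n; rewrite /intmul ?N M.
Qed.

Lemma coef_XaddC_exp (A : comNzRingType) (c : A) n i :
  (('X + c%:P) ^+ n)`_i = c ^+ (n - i) *+ 'C(n, i).
Proof.
rewrite addrC exprDn coef_sum.
under eq_bigr do rewrite coefMn -rmorphXn /= coefCM coefXn mulr_natr.
case: (ltnP i n.+1) => iN; last first.
  rewrite bin_small // mulr0n big1 // => k _.
  by rewrite (_ : (i == k) = false) ?mulr0n ?mul0rn //; apply/eqP; have := ltn_ord k; lia.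
rewrite (bigD1 (Ordinal iN)) //= eqxx big1 ?addr0 // => k ne.
rewrite (_ : (i == k) = false) ?mulr0n ?mul0rn //.
by apply: contra_neqF ne => /eqP E; apply/val_inj.
Qed.

Lemma mcoef_taylor_monom m (alpha : F) nu s :
  mcoef nu (taylor intr (fun=> alpha) m (monom m s)) =
    alpha ^+ (\sum_(h < m) (s h - nu h)) *+ (\prod_(h < m) 'C(s h, nu h)).
Proof.
elim: m => [|m IH]; first by rewrite /= !big_ord0 rmorph1.
rewrite /= rmorphM /= map_polyC /= map_polyXn comp_polyM comp_polyC rmorphXn /= comp_polyX.
rewrite coefCM coef_XaddC_exp -rmorphXn -raddfMn mcoefM_mconst IH.
by rewrite !big_ord_recr /= exprD mulrnA mulrnAl mulrnAr -!mulrnA mulnC.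
Qed.

Lemma index_ge_mcoef m (w : nat -> F) (t : F) (Q : mpol F m) :
  (forall nu : nat -> nat, \sum_(h < m) (nu h)%:R * w h < t -> mcoef nu Q = 0) -> index_ge w t Q.
Proof.
elim: m t Q => [|m IH] t Q H.
  have [t0|t0] := leP t 0; first by right.
  by left; have := H id; rewrite big_ord0 => /(_ t0).
move=> i; apply: IH => nu Hnu.
have := H (fun h => if h == m then i else nu h); rewrite big_ord_recr /= eqxx => <-.
  by apply: mcoef_ext => h hm; rewrite ltn_eqF.
rewrite -ltrBrDr; apply: le_lt_trans Hnu; apply: ler_sum => h _.
by rewrite ltn_eqF.
Qed.

Lemma bin_le_exp2 n k : ('C(n, k) <= 2 ^ n)%N.
Proof.
elim: n k => [|n IH] [|k]; rewrite ?bin0 ?expn_gt0 // binS expnS mul2n -addnn.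
exact: leq_add.
Qed.

Lemma auxiliary_polynomial (alpha : F) : algebraicOver (ratr : rat -> F) alpha ->
  exists C d : nat, (1 < C)%N /\ forall m eps r, (0 < m)%N -> 0 < eps ->
    d%:R <= 2 * eps ^+ 2 * m%:R -> (forall h, (h < m)%N -> (0 < r h)%N) ->
  exists P : mpol int m, [/\ P != 0, deg_le r P, l1norm P <= (C ^ (\sum_(h < m) r h))%:R &
    index_ge (winv r) (m%:R * (1 / 2 - eps)) (taylor intr (fun=> alpha) m P)].
Proof.
move=> /algebraic_powers[d [c [D [rho [c0 D0 rhole rhoE]]]]].
have aD : (0 < absz D)%N by rewrite absz_gt0.
exists (16 * absz D * c)%N, d; split; first by nia.
move=> m eps r m0 e0 dm r0; set K := (\sum_(h < m) r h)%N.
pose bx := box m r.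
pose p (s : seq nat) := \sum_(h < m) (nth 0%N s h)%:R / (r h)%:R <= m%:R * (1 / 2 - eps) :> F.
pose low := [seq s <- bx | p s].
have lowle : (2 * (size low * d) <= size bx)%N.
  have := chebyshev_box r0 e0; rewrite -size_filter -/low -/bx => low_le.
  have M0 : 0 < m%:R :> F by rewrite ltr0n.
  rewrite -(ler_nat F) -(ler_pM2r M0); apply: le_trans low_le.
  have -> : (2 * (size low * d))%:R * m%:R = (size low)%:R * (2 * d%:R * m%:R) :> F.
    by rewrite !natrM; ring.
  rewrite ler_wpM2l // [m%:R ^+ 2]expr2 mulrA ler_wpM2r //.
  by move: dm; lra.
pose A := ((2 * absz D * c) ^ K)%N.
have A0 : (0 < A)%N by rewrite expn_gt0 !muln_gt0 aD c0.
pose kk (s mu : nat -> nat) := (\sum_(h < m) (s h - mu h))%N.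
pose a (j : 'I_(size low) * 'I_d) (i : 'I_(size bx)) : int :=
  let s := nth 0%N (nth [::] bx i) in let mu := nth 0%N (nth [::] low j.1) in
  (\prod_(h < m) 'C(s h, mu h))%:R * (D ^+ (K - kk s mu) * rho (kk s mu) j.2).
pose S (i : 'I_(size bx)) := nth 0%N (nth [::] bx i).
have Sr i h : (h < m)%N -> (S i h <= r h)%N.
  by have [_] := boxP (mem_nth [::] (ltn_ord i)); apply.
have kkK i mu : (kk (S i) mu <= K)%N.
  by apply: leq_sum => h _; apply: leq_trans (leq_subr _ _) (Sr i h (ltn_ord h)).
have aA j i : (absz (a j i) <= A)%N.
  rewrite /a -/(S i); move: (nth 0%N (nth [::] low _)) => mu.
  rewrite !abszM abszX natz absz_nat /A !expnMn -mulnA leq_mul //.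
    apply: (@leq_trans (\prod_(h < m) 2 ^ r h)); last by rewrite -expn_sum.
    apply: leq_prod => h _; apply: leq_trans (leq_pexp2l _ (Sr i h (ltn_ord h))) => //.
    by apply: bin_le_exp2.
  rewrite leq_mul //; first by rewrite leq_pexp2l ?leq_subr.
  by apply: leq_trans (rhole _ _ (ltn_ord _)) _; rewrite leq_pexp2l.
have bx0 : (0 < size bx)%N by rewrite size_box prodn_gt0.
have [||x [[i0 xi0] xle xsol]] := siegel A0 aA; rewrite ?card_ord ?card_prod ?card_ord //.
exists (\sum_i monom m (S i) *~ x i); split.
- apply: contraNneq xi0 => /(congr1 (mcoef (S i0))); rewrite mcoef0 mcoef_sum.
  rewrite (bigD1 i0) //= big1 ?addr0 ?mcoefMz ?mcoef_monom => [|i ne]; first by move=> <-; rewrite intz.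
  have [h [hm Sh]] : exists h, (h < m)%N /\ S i0 h != S i h.
    apply: contrapT => no; case/eqP: ne; apply/val_inj/eqP.
    rewrite -(nth_uniq [::] (ltn_ord i) (ltn_ord i0) (box_uniq m r)).
    have [s1 _] := boxP (mem_nth [::] (ltn_ord i)); have [s2 _] := boxP (mem_nth [::] (ltn_ord i0)).
    apply/eqP/(@eq_from_nth _ 0%N); rewrite ?s1 ?s2 // => h hm.
    by apply/eqP; apply: contraT => ne; case: no; exists h; rewrite eq_sym.
  by rewrite mcoefMz (mcoef_monom0 hm Sh) mul0rz.
- apply: deg_le_sum => i _; move: (x i) (deg_le_monom (r:=r) (Sr i)) => [] n.
    exact: deg_leMn.
  by move=> /deg_leMn H; apply: deg_leN; apply: H.
- apply: le_trans (l1norm_sum _ _ _) _.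
  apply: (@le_trans _ _ (\sum_(i < size bx) (2 * size bx * A)%:R)).
    apply: ler_sum => i _; have := xle i; rewrite card_ord => xi.
    have -> : l1norm (monom m (S i) *~ x i) = `|x i|.
      by case: (x i) => n; rewrite /intmul ?l1normN l1normMn l1norm_monom ?normrN natz //.
    by rewrite natz; lia.
  rewrite sumr_const card_ord -mulrnA ler_nat.
  have bK : (size bx <= 2 ^ K)%N.
    by rewrite size_box /K expn_sum; apply: leq_prod => h _; apply: ltn_expl.
  have K2 : (2 <= 2 ^ K)%N.
    rewrite -{1}(expn1 2) leq_exp2l // /K (bigD1 (Ordinal m0)) //=.
    by apply: leq_trans (leq_addr _ _); apply: r0.
  have -> : ((16 * absz D * c) ^ K = 2 ^ K * (2 ^ K * (2 ^ K * A)))%N.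
    by rewrite /A -!expnMn; congr (_ ^ _)%N; lia.
  by rewrite -!mulnA leq_mul // leq_mul // mulnC leq_mul.
apply: index_ge_mcoef => nu low_nu; rewrite rmorph_sum mcoef_sum.
have [[h nuh]|nur] := pselect (exists h : 'I_m, (r h < nu h)%N).
  rewrite big1 // => i _; rewrite raddfMz mcoefMz mcoef_taylor_monom.
  rewrite [(\prod_(_ < m) _)%N](bigD1 h) //= bin_small.
    by rewrite mul0n mulr0n mul0rz.
  exact: leq_ltn_trans (Sr i h (ltn_ord h)) nuh.
have nub h : (h < m)%N -> (nu h <= r h)%N.
  by move=> hm; rewrite leqNgt; apply/negP => nh; apply: nur; exists (Ordinal hm).
have lowin : mkseq nu m \in low.
  rewrite mem_filter mem_box // andbT /p (le_trans _ (ltW low_nu)) //.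
  by apply: ler_sum => h _; rewrite nth_mkseq.
have DF : D%:~R ^+ K != 0 :> F by rewrite expf_neq0 // intr_eq0.
apply: (mulfI DF); rewrite mulr0 mulr_sumr.
have idx : (index (mkseq nu m) low < size low)%N by rewrite index_mem.
pose j l : 'I_(size low) * 'I_d := (Ordinal idx, l).
have nuE i : kk (S i) (nth 0%N (nth [::] low (Ordinal idx))) = kk (S i) nu.
  by apply: eq_bigr => h _; rewrite /= nth_index // nth_mkseq.
transitivity (\sum_(l < d) (\sum_i a (j l) i * x i)%:~R * alpha ^+ l : F); last first.
  by rewrite big1 // => l _; rewrite xsol mul0r.
under [RHS]eq_bigr do rewrite rmorph_sum mulr_suml.
rewrite [RHS]exchange_big; apply: eq_bigr => i _ /=.
rewrite raddfMz mcoefMz mcoef_taylor_monom.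
transitivity ((x i)%:~R * (\prod_(h < m) 'C(S i h, nu h))%:R * (D%:~R ^+ (K - kk (S i) nu) *
   (D%:~R ^+ kk (S i) nu * alpha ^+ kk (S i) nu)) : F).
  rewrite [X in _ = _ * X]mulrA -exprD subnK // -/(kk (S i) nu).
  by rewrite -[X in _ * X]mulrzr -[X in _ * (X * _)]mulr_natr; ring.
rewrite rhoE 2!mulr_sumr; apply: eq_bigr => l _.
rewrite /a /= -/(S i) !rmorphM /= rmorph_nat rmorphXn /=.
have -> : kk (S i) (nth 0%N (nth [::] low (index (mkseq nu m) low))) = kk (S i) nu by exact: nuE.
have -> : (\prod_(h < m) 'C(S i h, nth 0%N (nth [::] low (index (mkseq nu m) low)) h) =
   \prod_(h < m) 'C(S i h, nu h))%N.
  by apply: eq_bigr => h _; rewrite nth_index // nth_mkseq.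
by ring.
Qed.

End Auxiliary.

(** * Roth's theorem *)

Section Transfer.

Lemma taylor_expand (R S : idomainType) (f : {rmorphism R -> S}) xi m (P : {poly mpol R m}) :
  taylor f xi m.+1 P = \sum_(j < size P)
    (taylor f xi m P`_j)%:P * ('X + (mconst S m (xi m))%:P) ^+ j :> {poly mpol S m}.
Proof.
rewrite -{1}[P]coefK poly_def /= rmorph_sum rmorph_sum /=; apply: eq_bigr => j _.
by rewrite -mul_polyC rmorphM /= map_polyC /= map_polyXn comp_polyM comp_polyC rmorphXn /= comp_polyX.
Qed.

Lemma mcoef_taylor (R S : idomainType) (f : {rmorphism R -> S}) xi m mu (P : {poly mpol R m}) :
  mcoef mu (taylor f xi m.+1 P) = \sum_(j < size P)
    mcoef mu (taylor f xi m P`_j) * (xi m ^+ (j - mu m) *+ 'C(j, mu m)).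
Proof.
rewrite taylor_expand /= coef_sum mcoef_sum; apply: eq_bigr => j _.
by rewrite coefCM coef_XaddC_exp -rmorphXn -raddfMn mcoefM_mconst.
Qed.

Lemma deg_le_mconstM (R : idomainType) m r (P : mpol R m) c : deg_le r P -> deg_le r (P * mconst R m c).
Proof.
elim: m P => [|m IH] P // [sP cP]; split=> [|i]; last by rewrite /= coefMC; apply: IH; apply: cP.
by apply/leq_sizeP => i Hi; rewrite /= coefMC nth_default ?mul0r // (leq_trans sP).
Qed.

Lemma deg_le_taylor (R S : idomainType) (f : {rmorphism R -> S}) xi m r (P : mpol R m) :
  deg_le r P -> deg_le r (taylor f xi m P).
Proof.
elim: m P => [|m IH] P //; change {poly mpol R m} in P => -[sP cP]; split=> [|i].
  rewrite [taylor _ _ _ _]/= size_comp_poly2 ?size_XaddC //.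
  by apply: leq_trans sP; apply: size_poly.
rewrite taylor_expand coef_sum; apply: deg_le_sum => j _.
by rewrite coefCM coef_XaddC_exp -rmorphXn -raddfMn; apply: deg_le_mconstM; apply: IH; apply: cP.
Qed.

Lemma l1norm_exp (R : numDomainType) m (P : mpol R m) n : l1norm (P ^+ n) <= l1norm P ^+ n.
Proof.
elim: n => [|n IH]; first by rewrite l1norm1.
by rewrite !exprS; apply: le_trans (l1normM _ _) _; rewrite ler_wpM2l ?l1norm_ge0.
Qed.

Lemma l1norm_mconst (R : numDomainType) m (c : R) : l1norm (mconst R m c) = `|c|.
Proof. by elim: m => [|m IH] //; rewrite [LHS]l1normC. Qed.

Variable F : archiRealFieldType.
Notation ti := (@taylor int F intr).

Lemma l1norm_taylor (alpha : F) m r (P : mpol int m) : deg_le r P ->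
  l1norm (ti (fun=> alpha) m P) <= (1 + `|alpha|) ^+ (\sum_(h < m) r h) * (l1norm P)%:~R.
Proof.
have a1 : 1 <= 1 + `|alpha| by rewrite lerDl.
have a0 : 0 <= 1 + `|alpha| by apply: le_trans a1.
elim: m P => [|m IH] P; first by rewrite big_ord0 mul1r /= intr_norm.
change {poly mpol int m} in P => -[sP cP].
rewrite taylor_expand; apply: le_trans (l1norm_sum (m := m.+1) _ _ _) _.
rewrite [l1norm (P : mpol int m.+1)]/= rmorph_sum mulr_sumr; apply: ler_sum => j _.
apply: le_trans (l1normM (m := m.+1) _ _) _; rewrite l1normC.
have jr : (j <= r m)%N by rewrite -ltnS; apply: leq_trans sP.
have Xc : l1norm ('X + (mconst F m alpha)%:P : mpol F m.+1) <= 1 + `|alpha|.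
  apply: le_trans (l1normD (m := m.+1) _ _) _; rewrite l1normC l1norm_mconst lerD2r.
  by rewrite -['X]mul1r -['X]expr1 l1normXn -[1]/(1%:P) l1normC l1norm1.
have Xj : l1norm (('X + (mconst F m alpha)%:P) ^+ j : mpol F m.+1) <= (1 + `|alpha|) ^+ r m.
  apply: le_trans (l1norm_exp (m := m.+1) _ _) _.
  apply: le_trans (_ : (1 + `|alpha|) ^+ j <= _); last by rewrite ler_weXn2l.
  by rewrite lerXn2r ?nnegrE ?(l1norm_ge0 (m := m.+1)).
apply: le_trans (ler_pM (l1norm_ge0 _) (l1norm_ge0 (m := m.+1) _) (IH _ (cP j)) Xj) _.
by rewrite big_ord_recr exprD /= mulrAC.
Qed.

(* psi stands for x |-> exp (- L x). *)
Lemma mcoef_taylor_bound (psi : F -> F) (eta w : nat -> F) m r t (Q : mpol F m) (mu : nat -> nat) :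
  (forall x y, psi (x + y) = psi x * psi y) -> (forall x, 0 < psi x) ->
  (forall x y, x <= y -> psi y <= psi x) ->
  (forall h, (h < m)%N -> `|eta h| <= psi (w h)) -> deg_le r Q -> index_ge w t Q ->
  `|mcoef mu (taylor (idfun : {rmorphism F -> F}) eta m Q)|
    <= 2 ^+ (\sum_(h < m) r h) * l1norm Q * psi (t - \sum_(h < m) (mu h)%:R * w h).
Proof.
move=> psiD psi0 psi_le.
have psi0E : psi 0 = 1.
  by apply: (mulIf (x := psi 0)); rewrite ?gt_eqF // -psiD addr0 mul1r.
have psiM n x : psi x ^+ n = psi (n%:R * x).
  elim: n => [|n IH]; first by rewrite mul0r psi0E.
  by rewrite exprS IH -psiD -natr1 mulrDl mul1r addrC.
elim: m t Q => [|m IH] t Q etaw dQ oQ.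
  rewrite !big_ord0 subr0 mul1r /=.
  case: oQ => [->|t0]; first by rewrite normr0 mul0r.
  by rewrite ler_peMr // -psi0E psi_le.
change {poly mpol F m} in Q; have [sQ cQ] := dQ.
rewrite mcoef_taylor; apply: le_trans (ler_norm_sum _ _ _) _.
rewrite [l1norm (Q : mpol F m.+1)]/= mulr_sumr mulr_suml; apply: ler_sum => j _.
have jr : (j <= r m)%N by rewrite -ltnS; apply: leq_trans sQ.
rewrite normrM; case: (ltnP j (mu m)) => jmu.
  by rewrite bin_small // mulr0n normr0 mulr0 !mulr_ge0 ?exprn_ge0 ?l1norm_ge0 ?ltW.
have H1 := IH _ _ (fun h hm => etaw h (ltnW hm)) (cQ j) (oQ j).
have H2 : `|eta m ^+ (j - mu m) *+ 'C(j, mu m)| <= psi ((j - mu m)%:R * w m) * 2 ^+ r m.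
  rewrite normrMn normrX -[X in X <= _]mulr_natr ler_pM ?exprn_ge0 //.
    by rewrite -psiM lerXn2r ?nnegrE ?etaw // ltW.
  rewrite -natrX ler_nat; apply: leq_trans (bin_le_exp2 _ _) _.
  by rewrite leq_pexp2l.
apply: le_trans (ler_pM (normr_ge0 _) (normr_ge0 _) H1 H2) _.
rewrite !big_ord_recr exprD /= [psi (t - (_ + _))](_ : _ =
   psi (t - j%:R * w m - \sum_(h < m) (mu h)%:R * w h) * psi ((j - mu m)%:R * w m)); last first.
  by rewrite -psiD; congr psi; rewrite natrB //; ring.
by rewrite le_eqVlt; apply/orP; left; apply/eqP; ring.
Qed.

Lemma mcoef_taylor_int m r (p q : nat -> int) (P : mpol int m) mu :
  (forall h, (h < m)%N -> 0 < q h) -> deg_le r P ->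
  (\prod_(h < m) (q h)%:~R ^+ r h) * mcoef mu (ti (fun h => (p h)%:~R / (q h)%:~R) m P)
    \is a Num.int.
Proof.
elim: m P => [|m IH] P q0 dP; first by rewrite big_ord0 mul1r /= intr_int.
change {poly mpol int m} in P; have [sP cP] := dP.
rewrite mcoef_taylor mulr_sumr; apply: rpred_sum => j _.
rewrite big_ord_recr /= mulrACA; apply: rpredM; first by apply: IH (cP j) => h hm; apply/q0/ltnW.
have jr : (j <= r m)%N by rewrite -ltnS; apply: leq_trans sP.
rewrite mulrnAr; apply: rpredMn; rewrite expr_div_n.
have q0' : (q m)%:~R != 0 :> F by rewrite intr_eq0 gt_eqF ?q0.
have jr' : (j - mu m <= r m)%N by rewrite (leq_trans _ jr) // leq_subr.
rewrite -(subnK jr') exprD mulrA mulrAC mulfK ?expf_neq0 //.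
by apply: rpredM; apply: rpredX; apply: intr_int.
Qed.

Lemma index_transfer (psi : F -> F) (alpha : F) (w : nat -> F) m r (p q : nat -> int) t u (P : mpol int m) :
  (forall x y, psi (x + y) = psi x * psi y) -> (forall x, 0 < psi x) ->
  (forall x y, x <= y -> psi y <= psi x) ->
  (forall h, (h < m)%N -> 0 < q h) ->
  (forall h, (h < m)%N -> `|alpha - (p h)%:~R / (q h)%:~R| <= psi (w h)) ->
  deg_le r P -> index_ge w t (ti (fun=> alpha) m P) ->
  (\prod_(h < m) (q h)%:~R ^+ r h) * ((2 * (1 + `|alpha|)) ^+ (\sum_(h < m) r h) * (l1norm P)%:~R)
     * psi (t - u) < 1 ->
  index_ge w u (ti (fun h => (p h)%:~R / (q h)%:~R) m P).
Proof.
move=> psiD psi0 psi_le q0 close dP oP small; apply: index_ge_mcoef => mu mu_u.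
have Q0 : 0 < \prod_(h < m) (q h)%:~R ^+ r h :> F.
  by apply: prodr_gt0 => h _; rewrite exprn_gt0 // ltr0z q0.
have := mcoef_taylor_int (r := r) p mu q0 dP; set x := mcoef _ _.
move=> /intrP[z Ez].
suff : `|(\prod_(h < m) (q h)%:~R ^+ r h) * x| < 1.
  rewrite Ez -intr_norm -[1]/(1%:~R) ltr_int => z1.
  have z0 : z = 0 by lia.
  by move/eqP: Ez; rewrite z0 mulf_eq0 gt_eqF //= => /eqP.
apply: le_lt_trans small; rewrite normrM gtr0_norm // -mulrA ler_pM2l //.
rewrite /x -(@taylor_taylor _ _ _ intr (idfun : {rmorphism F -> F}) intr (fun=> alpha)
   (fun h => (p h)%:~R / (q h)%:~R - alpha)) //; last by move=> i /=; ring.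
apply: le_trans (mcoef_taylor_bound _ psiD psi0 psi_le _ (deg_le_taylor _ _ dP) oP) _.
  by move=> h hm; rewrite distrC close.
rewrite -mulrA exprMn -!mulrA ler_wpM2l ?exprn_ge0 //.
rewrite mulrA; apply: ler_pM; [exact: l1norm_ge0 | exact/ltW | exact: l1norm_taylor |].
by apply: psi_le; rewrite lerD2l lerN2 ltW.
Qed.

End Transfer.

Section RothTheorem.

Lemma denominator_chain (q : nat -> nat) (s m K : nat) :
  (0 < s)%N -> (1 < K)%N -> (1 < q 0%N)%N -> (forall h, (q h ^ (2 * s) < q h.+1)%N) ->
  exists N r, [/\ (0 < N)%N, forall h, (h < m)%N -> (0 < r h <= N)%N,
    forall h, (h < m)%N -> (q 0%N ^ N <= q h ^ r h)%N,
    forall h, (h < m)%N -> (q h ^ (r h).-1 < q 0%N ^ N)%N /\ (q h ^ K < q 0%N ^ N)%N &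
    forall h h', (h < h' < m)%N -> (s * r h' <= r h)%N].
Proof.
move=> s0 K1 q1 qS.
have qinc h : (q h < q h.+1)%N.
  apply: leq_ltn_trans (qS h); case: (q h) => [|x] //.
  by rewrite -{1}(expn1 x.+1) leq_pexp2l // muln_gt0.
have qmono h h' : (h <= h')%N -> (q h <= q h')%N.
  by apply: (homo_leq (r := leq)) => // [? ? ?|i]; [apply: leq_trans | apply/ltnW/qinc].
have qh1 h : (1 < q h)%N by apply: leq_trans q1 (qmono _ _ _).
pose N := (K * (\sum_(h < m) q h).+1)%N; pose Q := (q 0%N ^ N)%N.
have N0 : (0 < N)%N by rewrite muln_gt0 (ltn_trans _ K1).
have Q1 : (1 < Q)%N by rewrite -(expn0 (q 0%N)) ltn_exp2l.
have qK h : (h < m)%N -> (q h ^ K < Q)%N.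
  move=> hm; rewrite /Q /N mulnC expnM ltn_exp2r ?(ltn_trans _ K1) //.
  apply: (@leq_trans (2 ^ q h)); first exact: ltn_expl.
  apply: (@leq_trans (q 0%N ^ q h)); first by rewrite leq_exp2r // ltnW.
  by rewrite leq_exp2l // (bigD1 (Ordinal hm)) //= -addnS leq_addr.
pose r h := up_log (q h) Q.
have rP h : (Q <= q h ^ r h)%N by apply: up_logP.
have r0 h : (0 < r h)%N.
  by rewrite lt0n; apply: contraTneq (rP h) => ->; rewrite expn0 -ltnNge.
have rQ h : (q h ^ (r h).-1 < Q)%N.
  rewrite ltnNge; apply/negP => /(up_log_min (qh1 h)).
  by rewrite -/(r h); have := r0 h; lia.
exists N, r; split=> // [h hm|h hm|h h' /andP[hh hm]].
- by rewrite r0 up_log_min // leq_exp2r // qmono.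
- by split; [exact: rQ | exact: qK].
have r2 : (1 < r h')%N.
  rewrite ltn_neqAle r0 andbT; apply/negP => /eqP E.
  have := rP h'; rewrite -E expn1 leqNgt => /negP; apply.
  apply: leq_trans (qK _ hm); rewrite ltnS -{1}(expn1 (q h')) leq_exp2l // ltnW //.
have : (2 * s * (r h').-1 < r h)%N.
  rewrite -(ltn_exp2l _ _ (qh1 h)); apply: leq_trans (rP h).
  apply: leq_ltn_trans (rQ h'); rewrite expnM leq_exp2r; last by lia.
  by apply: leq_trans (ltnW (qS h)) (qmono _ _ hh).
by nia.
Qed.

Lemma roth_estimate (R : realType) (m N : nat) (r : nat -> nat) (q : nat -> R)
    (eps delta lam C1 : R) (K : nat) :
  0 < eps -> delta <= 1 -> delta = 40 * eps -> 1 <= eps * K%:R -> (0 < m)%N -> (0 < N)%N ->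
  0 < lam -> 0 < C1 -> ln C1 <= eps * lam -> 0 <= ln C1 ->
  (forall h, (h < m)%N -> (r h <= N)%N) ->
  (forall h, (h < m)%N -> 0 < q h) ->
  (forall h, (h < m)%N -> (r h)%:R * ln (q h) <= N%:R * lam + ln (q h)) ->
  (forall h, (h < m)%N -> K%:R * ln (q h) <= N%:R * lam) ->
  (\prod_(h < m) q h ^+ r h) * C1 ^+ (\sum_(h < m) r h)
    * expR (- ((2 + delta) * (N%:R * lam) * (m%:R * (1 / 2 - eps) - eps))) < 1.
Proof.
move=> e0 d1 dE eK m0 N0 lam0 C0 lnC lnC0 rN q0 Hr HK.
have -> : \prod_(h < m) q h ^+ r h = expR (\sum_(h < m) (r h)%:R * ln (q h)).
  rewrite expR_sum; apply: eq_bigr => h _.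
  by rewrite expRM_natl lnK // posrE; apply: q0.
have -> : C1 ^+ (\sum_(h < m) r h) = expR ((\sum_(h < m) r h)%:R * ln C1).
  by rewrite expRM_natl lnK.
rewrite -!expRD -[X in _ < X]expR0 ltr_expR.
set Lam := N%:R * lam in Hr HK *.
have L0 : 0 < Lam by rewrite mulr_gt0 ?ltr0n.
have S1 : \sum_(h < m) (r h)%:R * ln (q h) <= m%:R * ((1 + eps) * Lam).
  apply: (@le_trans _ _ (\sum_(h < m) (1 + eps) * Lam)).
    apply: ler_sum => h _; apply: le_trans (Hr h (ltn_ord h)) _.
    have := HK h (ltn_ord h); move: (ln _) => x Kx.
    have [x0|x0] := leP x 0; first by nra.
    have : x <= eps * K%:R * x by rewrite ler_peMl // ltW.
    by rewrite mulrDl mul1r lerD2l => /le_trans; apply; rewrite -mulrA ler_wpM2l // ltW.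
  by rewrite sumr_const card_ord -[X in X <= _]mulr_natl.
have S2 : (\sum_(h < m) r h)%:R * ln C1 <= m%:R * (eps * Lam).
  apply: (@le_trans _ _ ((m * N)%:R * ln C1)).
    apply: ler_wpM2r => //; rewrite ler_nat -[m in (m * _)%N]card_ord -sum_nat_const.
    by apply: leq_sum => h _; apply: rN.
  by rewrite natrM /Lam -mulrA ler_wpM2l // mulrCA ler_wpM2l // ltW.
have M1 : 1 <= m%:R :> R by rewrite ler1n.
have ML : 0 < m%:R * Lam by rewrite mulr_gt0 // ltr0n.
have e40 : eps <= 1 / 40 by lra.
have Y : m%:R * (1 / 2 - 2 * eps) <= m%:R * (1 / 2 - eps) - eps by nra.
have X : (1 + 14 * eps) * (m%:R * Lam) <= (2 + delta) * Lam * (m%:R * (1 / 2 - eps) - eps).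
  apply: (@le_trans _ _ ((2 + delta) * Lam * (m%:R * (1 / 2 - 2 * eps)))); last first.
    by rewrite ler_wpM2l // mulr_ge0 ?ltW //; lra.
  have -> : (2 + delta) * Lam * (m%:R * (1 / 2 - 2 * eps)) =
      ((2 + delta) * (1 / 2 - 2 * eps)) * (m%:R * Lam) by ring.
  rewrite (ler_wpM2r (ltW ML)) // dE.
  have : 0 <= eps * (1 / 40 - eps) by rewrite mulr_ge0 ?(ltW e0) // subr_ge0.
  by lra.
have eML : 0 < eps * (m%:R * Lam) by rewrite mulr_gt0.
move: X S1 S2 eML; move: (_ * (_ * _ - eps)) => Z; move: (\sum_(h < m) _) (_ * ln C1) => A B.
by lra.
Qed.

End RothTheorem.

Lemma ln_natX_le (R : realType) (a b x y : nat) : (0 < a)%N -> (0 < b)%N -> (a ^ x <= b ^ y)%N ->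
  x%:R * ln (a%:R : R) <= y%:R * ln b%:R.
Proof.
move=> a0 b0 le_ab; have pos c : (0 < c)%N -> 0 < c%:R :> R by rewrite ltr0n.
rewrite -ler_expR !expRM_natl !lnK ?posrE ?pos //.
by rewrite -!natrX ler_nat.
Qed.

Theorem roth (R : realType) (alpha delta : R) :
  algebraicOver (ratr : rat -> R) alpha -> 0 < delta ->
  (forall B : nat, exists p q : int, [/\ coprimez p q, B%:Z < q &
     `|alpha - p%:~R / q%:~R| <= q%:~R `^ (- (2 + delta))]) -> False.
Proof.
move=> alg d0 approx.
wlog d1 : delta d0 approx / delta <= 1.
  move=> W; have [d1|d1] := leP delta 1; first exact: W approx d1.
  apply: (W 1) => // B; have [p [q [cpq Bq close]]] := approx B.
  exists p, q; split=> //; apply: le_trans close _.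
  have q1 : 1 <= q%:~R :> R by rewrite -[1]/(1%:~R) ler_int; lia.
  by apply: ler_powR => //; rewrite lerN2 lerD2l ltW.
pose eps : R := delta / 40.
have e0 : 0 < eps by rewrite divr_gt0.
have dE : delta = 40 * eps by rewrite /eps; field.
have [C [d [C1 aux]]] := auxiliary_polynomial alg.
pose m := (Num.Def.archi_bound (d%:R / (2 * eps ^+ 2))).+1.
have dm : d%:R <= 2 * eps ^+ 2 * m%:R.
  have e2 : 0 < 2 * eps ^+ 2 by rewrite mulr_gt0 // exprn_gt0.
  rewrite mulrC -ler_pdivrMr //; apply/ltW/(lt_le_trans (archi_boundP _)).
    by rewrite divr_ge0 ?ler0n // ltW.
  by rewrite ler_nat.
have m0 : (0 < m)%N by [].
have e01 : 0 < eps <= 1 by rewrite e0 /=; lra.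
have [s [s0 rothl]] := roth_lemma m e01.
pose C1R : R := 2 * (1 + `|alpha|) * C%:R.
have C1R1 : 1 <= C1R.
  have : 1 <= C%:R :> R by rewrite ler1n ltnW.
  have := normr_ge0 alpha; rewrite /C1R; move: `|alpha| C%:R => x y; nra.
have lnC0 : 0 <= ln C1R by rewrite ln_ge0.
pose K := (Num.Def.archi_bound eps^-1).+1.
have eK : 1 <= eps * K%:R.
  rewrite mulrC -ler_pdivrMr // div1r; apply/ltW/(lt_le_trans (archi_boundP _)).
    by rewrite invr_ge0 ltW.
  by rewrite ler_nat.
have K1 : (1 < K)%N.
  rewrite ltnNge; apply/negP => K1; have : K%:R <= 1 :> R by rewrite lern1.
  by move: eK; move: K%:R => k; nra.
pose B0 := (Num.Def.archi_bound (expR (ln C1R / eps)) + C ^ (m * s) + 2)%N.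
have [f fP] : {f : nat -> int * int & forall B, [/\ coprimez (f B).1 (f B).2, B%:Z < (f B).2 &
     `|alpha - (f B).1%:~R / (f B).2%:~R| <= (f B).2%:~R `^ (- (2 + delta))]}.
  apply: (@choice _ _ (fun B (pq : int * int) => [/\ coprimez pq.1 pq.2, B%:Z < pq.2 &
     `|alpha - pq.1%:~R / pq.2%:~R| <= pq.2%:~R `^ (- (2 + delta))])) => B.
  by have [p [q H]] := approx B; exists (p, q).
pose fix b h : nat := if h is h'.+1 then (absz (f (b h')).2 ^ (2 * s))%N else B0.
pose p h := (f (b h)).1; pose q h := (f (b h)).2; pose qn h := absz (q h).
have q0 h : 0 < q h by have [_ + _] := fP (b h); apply: le_lt_trans.
have qE h : q h = (qn h)%:Z by rewrite /qn gtz0_abs.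
have qb h : (b h < qn h)%N by have [_ + _] := fP (b h); rewrite -/(q h) qE ltz_nat.
have [b1 b2 b3] : [/\ (Num.Def.archi_bound (expR (ln C1R / eps)) <= b 0)%N,
    (C ^ (m * s) <= b 0)%N & (1 < b 0)%N].
  have -> : b 0%N = B0 by [].
  rewrite /B0; move: (Num.Def.archi_bound _) (C ^ (m * s))%N => x y.
  by split; lia.
have qn01 : (1 < qn 0)%N by apply: ltn_trans (qb 0%N).
have [N [r [N0 rN Qr rK sr]]] := @denominator_chain qn s m K s0 K1 qn01 (fun h => qb h.+1).
pose lam : R := ln (qn 0)%:R.
have qnR : 1 < (qn 0%N)%:R :> R by rewrite ltr1n.
have qn0 h : (0 < qn h)%N by apply: leq_trans (qb h).
have lam0 : 0 < lam by rewrite ln_gt0.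
have lnC : ln C1R <= eps * lam.
  rewrite mulrC -ler_pdivrMr // -[X in X <= _]expRK ler_ln ?posrE ?expR_gt0 //; last by rewrite ltr0n ltnW.
  apply/ltW/(lt_le_trans (archi_boundP (expR_ge0 _))); rewrite ler_nat.
  exact: leq_trans b1 (ltnW (qb 0%N)).
have r0 h : (h < m)%N -> (0 < r h)%N by move=> /rN /andP[].
have [P [P0 dP nP oP]] := aux m eps r m0 e0 dm r0.
have Sr : (\sum_(h < m) r h <= m * N)%N.
  rewrite -[m in (m * _)%N]card_ord -sum_nat_const.
  by apply: leq_sum => h _; have /andP[] := rN h (ltn_ord h).
have [H HE] : exists H, H = (C ^ (m * N))%N by exists (C ^ (m * N))%N.
have nPH : l1norm P <= H%:R.
  by apply: le_trans nP _; rewrite ler_nat HE leq_pexp2l // ltnW.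
apply: (rothl r p q H P P0 dP nPH).
- move=> h hm; have /andP[rh0 rhN] := rN h hm; have [cpq _ _] := fP (b h).
  split=> //.
    by apply: (@leq_trans (2 ^ N)); [rewrite leq_pexp2l | rewrite HE expnM leq_exp2r //;
       apply: (leq_trans C1); rewrite -{1}(expn1 C) leq_pexp2l // ltnW].
  have -> : q h ^+ r h = (qn h ^ r h)%:R by rewrite qE natrX natz.
  rewrite ler_nat; apply: leq_trans (Qr h hm); rewrite HE -expnM mulnAC expnM leq_exp2r //.
  exact: leq_trans b2 (ltnW (qb 0%N)).
- exact: sr.
pose psi (x : R) := expR (- ((2 + delta) * (N%:R * lam) * x)).
apply: (index_transfer (psi := psi) (alpha := alpha) (r := r) (t := m%:R * (1 / 2 - eps)) _ _ _ _ _ dP oP).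
- by move=> x y; rewrite /psi -expRD; congr expR; ring.
- by move=> x; apply: expR_gt0.
- move=> x y xy; rewrite ler_expR lerN2 ler_wpM2l // !mulr_ge0 ?ler0n ?ltW //; lra.
- by move=> h _.
- move=> h hm; have [_ _ close] := fP (b h); apply: le_trans close _.
  have qh0 : 0 < (q h)%:~R :> R by rewrite ltr0z.
  rewrite /powR gt_eqF // ler_expR mulNr lerN2 -mulrA ler_wpM2l //; first lra.
  rewrite ler_pdivrMr ?ltr0n ?r0 // [leRHS]mulrC -/(q h) qE -pmulrn.
  exact: ln_natX_le (ltnW qn01) (qn0 h) (Qr h hm).
have small := roth_estimate (q := fun h => (q h)%:~R) e0 d1 dE eK m0 N0 lam0
   (lt_le_trans ltr01 C1R1) lnC lnC0 (fun h hm => proj2 (andP (rN h hm))).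
apply: le_lt_trans (small _ _ _) => [|h hm|h hm|h hm].
- apply: ler_wpM2r; first exact: expR_ge0.
  apply: ler_wpM2l; first by apply: prodr_ge0 => h _; rewrite exprn_ge0 // ler0z ltW.
  rewrite /C1R [X in _ <= X]exprMn; apply: ler_wpM2l; first by rewrite exprn_ge0 // mulr_ge0 // addr_ge0.
  have : (l1norm P)%:~R <= ((C ^ (\sum_(h < m) r h))%N%:Z)%:~R :> R.
    by rewrite ler_int -natz.
  by rewrite -pmulrn natrX.
- by rewrite ltr0z.
- have [rQ _] := rK h hm; rewrite qE -pmulrn.
  have := ln_natX_le R (qn0 h) (ltnW qn01) (ltnW rQ); rewrite -/lam.
  have -> : (r h)%:R = (r h).-1%:R + 1 :> R by rewrite natr1 prednK ?r0.
  by rewrite mulrDl mul1r lerD2r.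
have [_ rQ] := rK h hm; rewrite qE -pmulrn.
have := ln_natX_le R (qn0 h) (ltnW qn01) (ltnW rQ); rewrite mulrC.
by rewrite mulrC.
Qed.

(** * Jacobi's algorithm *)

Section Jacobi.
Variables (R : realType) (a b : nat -> int).

Lemma cauchy_tail (u x : nat -> R) (l : R) :
  (u @ \oo --> l)%classic -> (forall n, 0 <= x n) -> (forall n, x n.+1 <= x n / 2) ->
  (forall n, `|u n.+1 - u n| <= x n) -> forall n, `|l - u n| <= 2 * x n.
Proof.
move=> ul x0 xS ux n; apply/ler_addgt0Pr => e e0.
move/cvgrPdist_lt: ul => /(_ e e0)[k _ Hk].
have tele j : `|u (n + j)%N - u n| <= 2 * x n - 2 * x (n + j)%N.
  elim: j => [|j IH]; first by rewrite addn0 !subrr normr0.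
  rewrite addnS; have := ler_normD (u (n + j).+1 - u (n + j)%N) (u (n + j)%N - u n).
  rewrite addrA subrK; have := ux (n + j)%N; have := xS (n + j)%N; lra.
have := Hk (n + k)%N (leq_addl _ _); have := tele k; have := x0 (n + k)%N.
have := ler_normD (l - u (n + k)%N) (u (n + k)%N - u n); rewrite addrA subrK /=.
by lra.
Qed.

Notation A := (mcfA a b).
Notation B := (mcfB a b).
Notation C := (mcfC a b).

Definition jacobi_rec (u : nat -> int) := forall k, u k.+3 = a k * u k.+2 + b k * u k.+1 + u k.

Lemma jacobi_recA : jacobi_rec A. Proof. by []. Qed.
Lemma jacobi_recB : jacobi_rec B. Proof. by []. Qed.
Lemma jacobi_recC : jacobi_rec C. Proof. by []. Qed.

Lemma jacobi_rec_eq0 u n : jacobi_rec u -> (forall k, (n <= k)%N -> u k = 0) -> forall k, u k = 0.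
Proof.
move=> ur; elim: n => [|n IH] un k; first exact: un.
apply: IH => j; rewrite leq_eqVlt => /orP[/eqP <-|]; last exact: un.
have [u1 u2 u3] : [/\ u n.+1 = 0, u n.+2 = 0 & u n.+3 = 0] by split; apply: un; lia.
by have := ur n; rewrite u1 u2 u3 !mulr0 !add0r.
Qed.

Lemma jacobi_det k :
  A k.+2 * (B k.+1 * C k - B k * C k.+1) - B k.+2 * (A k.+1 * C k - A k * C k.+1)
    + C k.+2 * (A k.+1 * B k - A k * B k.+1) = 1.
Proof.
elim: k => [|k IH]; first by rewrite /= ; ring.
by rewrite -[RHS]IH (jacobi_recA k) (jacobi_recB k) (jacobi_recC k); ring.
Qed.

Definition cross (u : nat -> int) n := u n.+3 * C n.+2 - C n.+3 * u n.+2.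

Lemma cross_rec u n : jacobi_rec u ->
  cross u n.+3 = - b n.+3 * cross u n.+2 - a n.+2 * cross u n.+1 + cross u n.
Proof.
move=> ur; rewrite /cross (ur n.+3) (jacobi_recC n.+3).
by rewrite (ur n.+2) (jacobi_recC n.+2); ring.
Qed.

Lemma cross_eq0 u n : jacobi_rec u -> (forall k, (n <= k)%N -> cross u k = 0) -> forall k, cross u k = 0.
Proof.
move=> ur; elim: n => [|n IH] Tn k; first exact: Tn.
apply: IH => j; rewrite leq_eqVlt => /orP[/eqP <-|]; last exact: Tn.
have [T1 T2 T3] : [/\ cross u n.+1 = 0, cross u n.+2 = 0 & cross u n.+3 = 0].
  by split; apply: Tn; lia.
by have := cross_rec n ur; rewrite T1 T2 T3 !mulr0 subrr add0r.
Qed.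

Variable delta : R.
Hypotheses (adm : admissible a b) (delta0 : 0 < delta).
Hypothesis growth : forall n, (1 <= n)%N ->
  Num.max (`|cross A n|%:~R * (C n.+2)%:~R `^ delta) (`|cross B n|%:~R * (C n.+2)%:~R `^ delta)
    < (a n)%:~R.

Let c n : R := (C n.+3)%:~R.
Let x n : R := c n `^ (- (2 + delta)).

Lemma C_ge0 k : 0 <= C k.
Proof.
have [n] := ubnP k; elim: n k => // n IH [|[|[|[|k]]]] // kn; first by rewrite jacobi_recC !mulr0 !add0r.
rewrite jacobi_recC; have [a1 b0 _ _] := adm (ltn0Sn k).
have H1 : 0 <= C k.+3 by apply: IH; lia.
have H2 : 0 <= C k.+2 by apply: IH; lia.
have H3 : 0 <= C k.+1 by apply: IH; lia.
by nia.
Qed.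

Lemma C_step k : a k.+1 * C k.+3 <= C k.+4.
Proof.
rewrite (jacobi_recC k.+1); have [a1 b0 _ _] := adm (ltn0Sn k).
have := C_ge0 k.+2; have := C_ge0 k.+1; nia.
Qed.

Lemma C_ge1 k : 1 <= C k.+3.
Proof.
elim: k => [|k IH]; first by rewrite jacobi_recC !mulr0 !add0r.
by have := C_step k; have [a1 _ _ _] := adm (ltn0Sn k); nia.
Qed.

Lemma cross_nonzero n : (cross A n.+1 != 0) || (cross B n.+1 != 0).
Proof.
apply: contraT; rewrite negb_or !negbK => /andP[/eqP TA /eqP TB].
have := jacobi_det n.+2; have := C_ge1 n; move: TA TB; rewrite /cross.
move: (A n.+4) (B n.+4) (C n.+4) (A n.+3) (B n.+3) (C n.+3) (A n.+2) (B n.+2) (C n.+2).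
move=> A3 B3 C3 A2 B2 C2 A1 B1 C1 TA TB C20 det.
have : C2 * (A3 * (B2 * C1 - B1 * C2) - B3 * (A2 * C1 - A1 * C2) + C3 * (A2 * B1 - A1 * B2))
  = (A3 * C2 - C3 * A2) * (B2 * C1 - B1 * C2) - (B3 * C2 - C3 * B2) * (A2 * C1 - A1 * C2) by ring.
by rewrite det TA TB; lia.
Qed.

Lemma c_ge1 n : 1 <= c n. Proof. by rewrite /c -[1]/(1%:~R) ler_int C_ge1. Qed.

Lemma a_gt n : 1 < a n.+1.
Proof.
rewrite -(ltr_int R); apply: le_lt_trans (growth (ltn0Sn n)); rewrite le_max.
have c1 : 1 <= c n `^ delta by rewrite -(powRr0 (c n)) ler_powR ?c_ge1 // ltW.
have H (z : int) : z != 0 -> 1 <= `|z|%:~R * c n `^ delta.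
  move=> z0; have z1 : 1 <= `|z|%:~R :> R by rewrite -[1]/(1%:~R) ler_int -gtz0_ge1 normr_gt0.
  by rewrite -[X in X <= _]mulr1; apply: ler_pM.
by case/orP: (cross_nonzero n) => /H ->; rewrite ?orbT.
Qed.

Lemma c_double n : 2 * c n <= c n.+1.
Proof.
rewrite /c -[2]/(2%:~R) -intrM ler_int; apply: le_trans (C_step n).
by have := C_ge1 n; have := a_gt n; nia.
Qed.

Lemma c_ge n : n%:R <= c n.
Proof.
elim: n => [|n IH]; first by apply: le_trans (c_ge1 _).
by have := c_double n; have := c_ge1 n; rewrite -natr1; lra.
Qed.

Lemma c_gt0 n : 0 < c n. Proof. exact: lt_le_trans (c_ge1 n). Qed.

Lemma x_half n : x n.+1 <= x n / 2.
Proof.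
rewrite /x !powRN -invfM lef_pV2 ?posrE ?mulr_gt0 ?powR_gt0 ?c_gt0 //.
have d2 : 0 <= 2 + delta by have := delta0; lra.
apply: le_trans (_ : (2 * c n) `^ (2 + delta) <= _); last first.
  by apply: ge0_ler_powR (c_double n); rewrite ?nnegrE // ltW ?c_gt0 // mulr_gt0 ?c_gt0.
rewrite powRM ?(ltW (c_gt0 n)) // mulrC ler_wpM2r ?powR_ge0 //.
rewrite -[X in X <= _](powRr1 (a := 2)) // ler_powR //; have := delta0; lra.
Qed.

Lemma ratio_diff u n :
  (u n.+4)%:~R / c n.+1 - (u n.+3)%:~R / c n = (cross u n.+1)%:~R / (c n.+1 * c n).
Proof.
rewrite /cross /c rmorphB !rmorphM /=; field.
by rewrite !gt_eqF ?c_gt0.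
Qed.

Lemma ratio_step u n : (`|cross u n.+1|%:~R * c n `^ delta <= (a n.+1)%:~R) ->
  `|(u n.+4)%:~R / c n.+1 - (u n.+3)%:~R / c n| <= x n.
Proof.
move=> le_a.
rewrite ratio_diff normrM normfV (gtr0_norm (mulr_gt0 (c_gt0 _) (c_gt0 _))) -intr_norm.
rewrite ler_pdivrMr ?mulr_gt0 ?c_gt0 //.
have cS : (a n.+1)%:~R * c n <= c n.+1 by rewrite /c -intrM ler_int C_step.
have xE : x n * (c n `^ delta * (c n * c n)) = 1.
  rewrite /x powRN powRD ?(gt_eqF (c_gt0 n)) ?implybT //.
  rewrite -[c n * c n]expr2 -(powR_mulrn 2 (ltW (c_gt0 n))) mulrC [_ * c n `^ 2]mulrC.
  by rewrite divff // gt_eqF // mulr_gt0 ?powR_gt0 ?c_gt0.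
have x0 : 0 <= x n by exact: powR_ge0.
apply: (@le_trans _ _ (x n * ((a n.+1)%:~R * c n * c n))); last first.
  by rewrite ler_wpM2l // ler_wpM2r // ltW ?c_gt0.
apply: (@le_trans _ _ (x n * (`|cross u n.+1|%:~R * c n `^ delta * c n * c n))); last first.
  by rewrite ler_wpM2l // !ler_wpM2r // ltW ?c_gt0.
rewrite -[X in X <= _]mul1r -xE le_eqVlt; apply/orP; left; apply/eqP; ring.
Qed.

Lemma ratio_close u l : (forall n, `|cross u n.+1|%:~R * c n `^ delta <= (a n.+1)%:~R) ->
  ((fun n => (u n.+3)%:~R / c n) @ \oo --> l)%classic ->
  forall n, `|l - (u n.+3)%:~R / c n| <= 2 * x n.
Proof.
move=> le_a ul n; apply: (cauchy_tail ul) => // k; [exact: powR_ge0 | exact: x_half |].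
exact: ratio_step.
Qed.

Lemma x_le n : x n * c n ^+ 2 <= 1.
Proof.
have c2 : 0 < c n ^+ 2 by rewrite exprn_gt0 ?c_gt0.
rewrite -ler_pdivlMr // div1r /x powRN lef_pV2 ?posrE ?powR_gt0 ?c_gt0 //.
rewrite -powR_mulrn ?(ltW (c_gt0 n)) // ler_powR ?c_ge1 //.
by have := delta0; lra.
Qed.

Lemma reduced_fraction (u v : int) : 0 < v ->
  exists p q : int, [/\ coprimez p q, 0 < q <= v & p * v = u * q].
Proof.
move=> v0; pose g := gcdz u v.
have g0 : 0 < g by rewrite /g /gcdz ltz_nat gcdn_gt0 !absz_gt0 (gt_eqF v0) orbT.
have [p Ep] := dvdzP (dvdz_gcdl u v); have [q Eq] := dvdzP (dvdz_gcdr u v).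
rewrite -/g in Ep Eq; exists p, q; split.
- rewrite /coprimez; apply/eqP/(mulIf (x := `|g|)); first by rewrite normr_eq0 gt_eqF.
  by rewrite -abszE mulz_gcdl -Ep -Eq mul1r abszE gtr0_norm.
- by nia.
- by rewrite {1}Eq {1}Ep; ring.
Qed.

Lemma transcendental_limit u l : jacobi_rec u -> (exists n, cross u n != 0) ->
  (forall n, `|cross u n.+1|%:~R * c n `^ delta <= (a n.+1)%:~R) ->
  ((fun n => (u n.+3)%:~R / c n) @ \oo --> l)%classic -> transcendental l.
Proof.
move=> ur [n0 Tn0] le_a ul alg; have lc := ratio_close le_a ul.
have d2 : 0 < delta / 2 by rewrite divr_gt0.
apply: (roth alg d2) => B0; apply: contrapT => no.
pose N := (Num.Def.archi_bound (2 `^ (2 / delta) : R) + B0.+1)%N.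
have cN n : (N <= n)%N -> 2 `^ (2 / delta) <= c n /\ B0%:R < c n.
  move=> Nn; split.
    apply: le_trans (c_ge n); apply/ltW/(lt_le_trans (archi_boundP (powR_ge0 _ _))).
    by rewrite ler_nat (leq_trans _ Nn) // leq_addr.
  by apply: lt_le_trans (c_ge n); rewrite ltr_nat (leq_trans _ Nn) // leq_addl.
have small n : (N <= n)%N -> exists p q : int, 0 < q <= B0%:Z /\ p * C n.+3 = u n.+3 * q.
  move=> Nn; have [p [q [cpq /andP[q0 qC] E]]] := reduced_fraction (u n.+3) (C_ge1 n).
  exists p, q; split=> //; rewrite q0 leNgt; apply/negP => qB; case: no; exists p, q; split=> //.
  have qr0 : 0 < q%:~R :> R by rewrite ltr0z.
  have -> : p%:~R / q%:~R = (u n.+3)%:~R / c n.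
    apply/eqP; rewrite eqr_div; first by rewrite /c -!intrM E.
      by rewrite gt_eqF.
    by rewrite gt_eqF // c_gt0.
  apply: le_trans (lc n) _.
  have cn : 2 <= c n `^ (delta / 2).
    have [cn _] := cN n Nn.
    have E2 : (2 `^ (2 / delta)) `^ (delta / 2) = 2 :> R.
      rewrite -powRrM (_ : 2 / delta * (delta / 2) = 1) ?powRr1 //.
      by field; rewrite gt_eqF.
    rewrite -[X in X <= _]E2.
    by apply: ge0_ler_powR cn; rewrite ?nnegrE ?powR_ge0 // ltW ?c_gt0.
  have cq : q%:~R <= c n by rewrite ler_int.
  apply: (@le_trans _ _ (c n `^ (- (2 + delta / 2)))); last first.
    rewrite !powRN lef_pV2 ?posrE ?powR_gt0 ?c_gt0 //.
    by apply: ge0_ler_powR; rewrite ?nnegrE // ltW ?c_gt0 //; have := delta0; lra.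
  have -> : - (2 + delta / 2) = delta / 2 + - (2 + delta) by field.
  rewrite powRD ?(gt_eqF (c_gt0 n)) ?implybT //.
  by rewrite ler_wpM2r ?powR_ge0.
have T0 n : (N <= n)%N -> cross u n.+1 = 0.
  move=> Nn; apply/eqP; apply: contraT => T.
  have [p [q [/andP[q0 qB] E]]] := small n Nn.
  have [p' [q' [/andP[q0' qB'] E']]] := small n.+1 (leqW Nn).
  have id : q * q' * cross u n.+1 = C n.+3 * C n.+4 * (q * p' - q' * p).
    rewrite /cross.
    have -> : q * q' * (u n.+4 * C n.+3 - C n.+4 * u n.+3) =
      q * C n.+3 * (u n.+4 * q') - q' * C n.+4 * (u n.+3 * q) by ring.
    by rewrite -E -E'; ring.
  have C0 := C_ge1 n; have C1 := C_ge1 n.+1.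
  have nz : q * p' - q' * p != 0.
    apply: contraNneq T => z; move: id; rewrite z mulr0 => /eqP.
    by rewrite !mulf_eq0 (gt_eqF q0) (gt_eqF q0').
  have le1 : C n.+3 * C n.+4 <= B0%:Z ^+ 2 * `|cross u n.+1|.
    apply: (@le_trans _ _ (C n.+3 * C n.+4 * `|q * p' - q' * p|)).
      by rewrite ler_peMr //; [rewrite mulr_ge0 // ltW | rewrite -gtz0_ge1 normr_gt0].
    have -> : C n.+3 * C n.+4 * `|q * p' - q' * p| = `|q * q' * cross u n.+1|.
      by rewrite id normrM gtr0_norm // mulr_gt0.
    rewrite normrM gtr0_norm ?mulr_gt0 // ler_wpM2r // expr2 ler_pM // ltW //.
  have := ratio_step (le_a n).
  have cc0 : 0 < c n.+1 * c n by rewrite mulr_gt0 ?c_gt0.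
  rewrite ratio_diff normrM normfV (gtr0_norm cc0) -intr_norm ler_pdivrMr // => Tx.
  have {}le1 : c n * c n.+1 <= B0%:R ^+ 2 * `|cross u n.+1|%:~R.
    by rewrite /c [B0%:R]pmulrn -rmorphXn /= -!intrM ler_int.
  have [_ Bc] := cN n Nn; have := x_le n; have c0 := c_gt0 n.
  have x0 : 0 < x n by rewrite powR_gt0.
  have le2 : c n * c n.+1 <= B0%:R ^+ 2 * (x n * (c n.+1 * c n)).
    by apply: le_trans le1 _; rewrite ler_wpM2l // exprn_ge0.
  have : 1 <= x n * B0%:R ^+ 2 by rewrite -(ler_pM2r cc0) mul1r; move: le2; lra.
  have : x n * B0%:R ^+ 2 < x n * c n ^+ 2 by rewrite ltr_pM2l // ltrXn2r ?nnegrE ?(ltW c0).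
  by lra.
case/eqP: Tn0; apply: (@cross_eq0 u N.+1 ur) => -[//|k] Nk.
exact: T0.
Qed.

Lemma independent_limits alpha beta :
  ((fun n => (A n.+3)%:~R / c n) @ \oo --> alpha)%classic ->
  ((fun n => (B n.+3)%:~R / c n) @ \oo --> beta)%classic ->
  rationally_independent alpha beta.
Proof.
move=> Aa Bb p q pq0.
have le_aA n : `|cross A n.+1|%:~R * c n `^ delta <= (a n.+1)%:~R.
  by apply: le_trans (ltW (growth (ltn0Sn n))); rewrite le_max lexx.
have le_aB n : `|cross B n.+1|%:~R * c n `^ delta <= (a n.+1)%:~R.
  by apply: le_trans (ltW (growth (ltn0Sn n))); rewrite le_max lexx orbT.
have lA := ratio_close le_aA Aa; have lB := ratio_close le_aB Bb.
pose P := numq p * denq q; pose Q := numq q * denq p.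
have PQ0 : P%:~R * alpha + Q%:~R * beta = 0.
  have := congr1 (fun z => (denq p)%:~R * (denq q)%:~R * z) pq0; rewrite mulr0 => <-.
  have dp (z : rat) : (denq z)%:~R * ratr z = (numq z)%:~R :> R.
    by rewrite /ratr mulrC divfK // intr_eq0 denq_neq0.
  by rewrite /P /Q !intrM -!dp; ring.
pose u k := P * A k + Q * B k.
have ur : jacobi_rec u by move=> k; rewrite /u jacobi_recA jacobi_recB; ring.
pose M := (absz P + absz Q)%N.
have un n : (2 * M < n)%N -> u n.+3 = 0.
  move=> Mn.
  have E : (u n.+3)%:~R / c n = - (P%:~R * (alpha - (A n.+3)%:~R / c n) + Q%:~R * (beta - (B n.+3)%:~R / c n)).
    rewrite [RHS](_ : _ = (P%:~R * (A n.+3)%:~R + Q%:~R * (B n.+3)%:~R) / c n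
       - (P%:~R * alpha + Q%:~R * beta)); last by ring.
    by rewrite PQ0 subr0 /u rmorphD !rmorphM.
  have : `|(u n.+3)%:~R / c n| <= M%:R * (2 * x n).
    rewrite E normrN; apply: le_trans (ler_normD _ _) _.
    rewrite !normrM -!intr_norm /M natrD mulrDl.
    by rewrite !pmulrn !abszE lerD // ler_wpM2l // ler0z.
  rewrite normrM normfV (gtr0_norm (c_gt0 n)) -intr_norm ler_pdivrMr ?c_gt0 // => Hu.
  have : `|u n.+3|%:~R < 1 :> R.
    have := x_le n; have := c_ge n; have := c_gt0 n.
    have : 2 * M%:R < n%:R :> R by rewrite -natrM ltr_nat.
    have : 0 <= x n by exact: powR_ge0.
    move=> x0 Mn' c0 nc x1; apply: le_lt_trans Hu _.
    apply: (@lt_le_trans _ _ (x n * c n ^+ 2)) => //.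
    have xc : 0 < x n * c n by rewrite mulr_gt0 // powR_gt0.
    have -> : M%:R * (2 * x n) * c n = 2 * M%:R * (x n * c n) by ring.
    have -> : x n * c n ^+ 2 = c n * (x n * c n) by ring.
    by rewrite ltr_pM2r // (lt_le_trans Mn').
  by rewrite -[1]/(1%:~R) ltr_int; lia.
have u0 := jacobi_rec_eq0 (n := (2 * M).+4) ur.
have {}u0 k : u k = 0.
  by apply: u0 => -[|[|[|j]]] // Mj; apply: un; lia.
have := u0 2; have := u0 1; rewrite /u /= !mulr0 !mulr1 add0r addr0 => /eqP Q0 /eqP P0.
move: P0 Q0; rewrite !mulf_eq0 !(negbTE (denq_neq0 _)) !orbF !numq_eq0.
by move=> /eqP -> /eqP ->.
Qed.

End Jacobi.

Local Open Scope classical_set_scope.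

Theorem theorem19 (R : realType) (a b : nat -> int) (alpha0 beta0 delta : R)
  (hadm : admissible a b)
  (hcvg : mcf_converges a b alpha0 beta0)
  (hdelta : 0 < delta)
  (hgrowth : forall n : nat, (1 <= n)%N ->
     Num.max (`|tildeA a b n|%:~R * (mcfC a b n.+2)%:~R `^ delta)
             (`|tildeB a b n|%:~R * (mcfC a b n.+2)%:~R `^ delta)
       < (a n)%:~R) :
  [/\ transcendental alpha0, transcendental beta0
    & rationally_independent alpha0 beta0].
Proof.
case: hcvg => lA lB.
have growth n : (1 <= n)%N ->
    Num.max (`|cross a b (mcfA a b) n|%:~R * (mcfC a b n.+2)%:~R `^ delta)
            (`|cross a b (mcfB a b) n|%:~R * (mcfC a b n.+2)%:~R `^ delta) < (a n)%:~R.
  by move=> /hgrowth; rewrite /tildeB [mcfB a b n.+2 * _]mulrC.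
split.
- apply: (transcendental_limit hadm hdelta growth (@jacobi_recA a b) _ _ lA).
    by exists 0%N; have -> : cross a b (mcfA a b) 0 = -1 by rewrite /cross /mcfA /mcfB /mcfC /=; ring.
  by move=> n; apply: le_trans (ltW (growth n.+1 isT)); rewrite le_max lexx.
- apply: (transcendental_limit hadm hdelta growth (@jacobi_recB a b) _ _ lB).
    by exists 1%N; have -> : cross a b (mcfB a b) 1 = 1 by rewrite /cross /mcfA /mcfB /mcfC /=; ring.
  by move=> n; apply: le_trans (ltW (growth n.+1 isT)); rewrite le_max lexx orbT.
exact: (independent_limits hadm hdelta growth lA lB).
Qed.
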